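(* Let $X$ be a smooth projective curve over $\mathbb{C}$, $V\to X$ a vector bundle of rank $2$, and $b\in\mathcal{B}'$. If the modification $\tilde Y_b$ of the spectral curve is irreducible, then $\tilde Y_b$ is smooth if and only if $b$ does not have a multiple zero.
   Context: In a local frame $v_1,v_2$ of $V$, write a section $b$ of $\operatorname{Sym}^2V$ as $b=b_1v_1^2+b_2v_2^2+2b_3v_1v_2$, abbreviated $(b_1,b_2,b_3)$. The Hitchin base is $\mathcal{B}=\{b\in H^0(X,\operatorname{Sym}^2V):\text{locally } b_3^2=b_1b_2\}$, and $\mathcal{B}'\subset\mathcal{B}$ is the subset of sections that do not vanish at the generic point of $X$. A multiple zero of $b$ is a point $x\in X$ at which the section $b$ of $\operatorname{Sym}^2V$ vanishes to order at least $2$, i.e. all of $b_1,b_2,b_3$ vanish to order at least $2$ at $x$. For $b\in\mathcal{B}$ the spectral curve $Y_b$ is the closed subscheme of the total space of $V$ given locally, in the fibre coordinates $\mathsf{X},\mathsf{Y}$ associated with the frame, by the ideal $(\mathsf{X}^2-b_1,\mathsf{Y}^2-b_2,\mathsf{X}\mathsf{Y}-b_3)$; $\pi:Y_b\to X$ is the restriction of the bundle projection, a finite morphism. Let $T\subset\pi_*\mathcal{O}_{Y_b}$ be the torsion subsheaf. The modification is the closed subscheme $\tilde Y_b=\underline{\mathrm{Spec}}(\pi_*\mathcal{O}_{Y_b}/T)\subset Y_b$. *)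

(* Defs.v *)
From HB Require Import structures.
From mathcomp Require Import all_boot all_order all_algebra.
From mathcomp Require Import all_classical all_reals topology.
From mathcomp Require Import complex.
(* The notations of mpoly clash with those of MathComp-Analysis. *)
From mathcomp Require Import -(notations) mpoly.

Set Implicit Arguments.
Unset Strict Implicit.
Unset Printing Implicit Defensive.

Import GRing.Theory.
Local Open Scope classical_set_scope.
Local Open Scope ring_scope.

(* Rings of sections may be zero (over the empty set), so commutative algebra *)
(* is done over comPzRingType, which carries no unit predicate.               *)
Section CommutativeAlgebra.

Definition invertible (A : comPzRingType) (a : A) : Prop := exists b, a * b = 1.

Variables A B : comPzRingType.

Definition prime_ideal (P : set A) : Prop :=
  [/\ P 0, forall f g, P f -> P g -> P (f + g), forall f g, P g -> P (f * g),
      ~ P 1 & forall f g, P (f * g) -> P f \/ P g].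

(* phi exhibits B as the localization A[1/f]. *)
Definition localization_away (phi : A -> B) (f : A) : Prop :=
  [/\ invertible (phi f),
      forall s, exists g n, s * phi f ^+ n = phi g &
      forall g, phi g = 0 -> exists n, f ^+ n * g = 0].

Definition monomial n (x : n.-tuple B) (m : {ffun 'I_n -> nat}) : B :=
  \prod_(i < n) tnth x i ^+ m i.

(* phi exhibits B as the polynomial algebra A[x_1, ..., x_n]: the monomials   *)
(* in x form a basis of B as an A-module.                                     *)
Definition polynomial_algebra (phi : A -> B) n (x : n.-tuple B) : Prop :=
  (forall s, exists (M : seq {ffun 'I_n -> nat}) (c : {ffun 'I_n -> nat} -> A),
      s = \sum_(m <- M) phi (c m) * monomial x m) /\
  (forall (M : seq {ffun 'I_n -> nat}) (c : {ffun 'I_n -> nat} -> A), uniq M ->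
      \sum_(m <- M) phi (c m) * monomial x m = 0 ->
      forall m, m \in M -> c m = 0).

End CommutativeAlgebra.

(* Same formula as mpoly.mmap, which is only available for nonzero target     *)
(* rings.                                                                     *)
Definition mpeval (k : fieldType) (B : comPzRingType) (phi : k -> B)
    n (x : n.-tuple B) (p : mpoly n k) : B :=
  \sum_(m <- msupp p)
    phi (mcoeff m p) * \prod_(i < n) tnth x i ^+ m i.

(* phi : k -> B has a presentation                                            *)
(*   B = k[x_1, ..., x_(c + d)] / (f_1, ..., f_c)                             *)
(* in which the minor det (df_i/dx_(d + j))_(i, j <= c) is invertible.        *)
Definition standard_smooth (k : fieldType) (B : comPzRingType) (phi : k -> B)
    (d : nat) : Prop :=
  exists (c : nat) (x : (d + c).-tuple B) (f : 'I_c -> mpoly (d + c) k),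
  [/\ forall s, exists p, s = mpeval phi x p,
      forall p, mpeval phi x p = 0 <->
        exists q : 'I_c -> mpoly (d + c) k, p = \sum_(i < c) q i * f i &
      invertible (\det (\matrix_(i < c, j < c)
        mpeval phi x (mderiv (rshift d j) (f i))))].

Record opens (T : topologicalType) := Opens {
  open_set :> set T;
  open_setP : open open_set }.

Definition in_open (T : topologicalType) (U : opens T) (x : T) : Prop :=
  open_set U x.
Coercion in_open : opens >-> Funclass.

Definition fullU (T : topologicalType) : opens T := Opens openT.

Lemma sub_fullU (T : topologicalType) (U : opens T) : U `<=` fullU T.
Proof. exact: subsetT. Qed.

Definition preimU (S T : topologicalType) (f : S -> T) (fc : continuous f)
  (U : opens T) : opens S :=
  Opens ((continuousP f).1 fc _ (open_setP U)).

Definition irreducible_space (T : topologicalType) : Prop :=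
  (exists x : T, True) /\
  forall F G : set T, closed F -> closed G -> F `|` G = setT ->
    F = setT \/ G = setT.

(* A topological space with a sheaf of commutative k-algebras. *)
Record ringed_space (k : fieldType) := RingedSpace {
  space :> topologicalType;
  sec : opens space -> comPzRingType;
  res : forall U W : opens space, W `<=` U -> {rmorphism sec U -> sec W};
  res_id : forall (U : opens space) (h : U `<=` U) (s : sec U), res h s = s;
  res_comp : forall (U W Z : opens space) (h : W `<=` U) (h' : Z `<=` W)
    (h'' : Z `<=` U) (s : sec U), res h' (res h s) = res h'' s;
  sec_separated : forall (I : Type) (U : opens space) (C : I -> opens space)
    (h : forall i, C i `<=` U) (s : sec U), open_set U = \bigcup_i C i ->
    (forall i, res (h i) s = 0) -> s = 0;
  sec_glue : forall (I : Type) (U : opens space) (C : I -> opens space)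
    (h : forall i, C i `<=` U) (s : forall i, sec (C i)),
    open_set U = \bigcup_i C i ->
    (forall (i j : I) (W : opens space) (hi : W `<=` C i) (hj : W `<=` C j),
       res hi (s i) = res hj (s j)) ->
    exists t : sec U, forall i, res (h i) t = s i;
  scalarT : {rmorphism k -> sec (fullU space)} }.

Arguments sec {k r} U.
Arguments res {k r U W} h.

Section RingedSpaces.
Variables (k : fieldType) (X : ringed_space k).

Definition scalar (U : opens X) (a : k) : sec U := res (@sub_fullU _ U) (scalarT X a).

(* The germ of s at x is a unit of the stalk. *)
Definition invertible_at (U : opens X) (s : sec U) (x : X) : Prop :=
  exists (W : opens X) (h : W `<=` U), W x /\ invertible (res h s).

Definition nonvanishing (U : opens X) (s : sec U) : set X :=
  [set x | invertible_at s x].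

(* For x in U: the sections over U with value 0 in the residue field at x. *)
Definition point_ideal (U : opens X) (x : X) : set (sec U) :=
  [set s | ~ invertible_at s x].

(* The canonical map U -> Spec (sec U), sending x to its point ideal, is an   *)
(* isomorphism: it is a homeomorphism, and sections over basic open sets are  *)
(* the localizations.                                                         *)
Definition affine_open (U : opens X) : Prop :=
  [/\ forall x, U x -> prime_ideal (@point_ideal U x),
      forall P : set (sec U), prime_ideal P ->
        exists! x, U x /\ @point_ideal U x = P,
      forall (W : opens X) x, W `<=` U -> W x ->
        exists f : sec U, nonvanishing f x /\ nonvanishing f `<=` W &
      forall (f : sec U) (W : opens X) (h : W `<=` U),
        open_set W = nonvanishing f -> localization_away (res h) f].

Definition is_scheme : Prop :=
  forall x : X, exists U : opens X, U x /\ affine_open U.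

(* The germ of s at x lies in the n-th power of the maximal ideal of the      *)
(* stalk at x.                                                                *)
Definition vanishes_to_order (n : nat) (U : opens X) (s : sec U) (x : X) : Prop :=
  exists (W : opens X) (h : W `<=` U), W x /\
  exists (m : nat) (a : 'I_m -> sec W) (t : 'I_m -> 'I_n -> sec W),
    (forall i j, point_ideal x (t i j)) /\
    res h s = \sum_(i < m) a i * \prod_(j < n) t i j.

Definition generic_point (x : X) : Prop := closure [set x] = setT.

End RingedSpaces.

Arguments scalar {k X} U a.

Record scheme (k : fieldType) := Scheme {
  scheme_space :> ringed_space k;
  schemeP : is_scheme scheme_space }.

Record morphism (k : fieldType) (X Y : ringed_space k) := Morphism {
  mor :> X -> Y;
  mor_continuous : continuous mor;
  pull : forall U : opens Y, {rmorphism sec U -> sec (preimU mor_continuous U)};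
  pull_res : forall (U W : opens Y) (h : W `<=` U)
    (h' : preimU mor_continuous W `<=` preimU mor_continuous U) (s : sec U),
    pull W (res h s) = res h' (pull U s);
  pull_scalar : forall (U : opens Y) (a : k), pull U (scalar U a) = scalar _ a;
  pull_local : forall (U : opens Y) (s : sec U) (x : X),
    invertible_at (pull U s) x -> invertible_at s (mor x) }.

Definition inv_im (k : fieldType) (X Y : ringed_space k) (f : morphism X Y)
  (U : opens Y) : opens X := preimU (@mor_continuous _ _ _ f) U.

Definition pullback (k : fieldType) (X Y : ringed_space k) (f : morphism X Y)
  (U : opens Y) : {rmorphism sec U -> sec (inv_im f U)} := @pull _ _ _ f U.

Lemma inv_im_sub (k : fieldType) (X Y : ringed_space k) (f : morphism X Y)
  (U W : opens Y) (h : W `<=` U) : inv_im f W `<=` inv_im f U.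
Proof. by move=> x; apply: h. Qed.

Arguments inv_im_sub {k X Y} f {U W} h.

Section Composition.
Variables (k : fieldType) (X Y Z : ringed_space k).
Variables (g : morphism Y Z) (f : morphism X Y).

Lemma mor_comp_continuous : continuous (g \o f).
Proof.
by move=> x; apply: continuous_comp; [exact: mor_continuous|exact: mor_continuous].
Qed.

(* The two spaces of sections only differ by the proof of openness. *)
Lemma inv_im_comp_sub (U : opens Z) : preimU mor_comp_continuous U `<=` inv_im f (inv_im g U).
Proof. by []. Qed.

Definition pull_comp (U : opens Z) : {rmorphism sec U -> sec (preimU mor_comp_continuous U)} :=
  res (@inv_im_comp_sub U) \o pullback f (inv_im g U) \o pullback g U.

Lemma pull_comp_res (U W : opens Z) (h : W `<=` U)
  (h' : preimU mor_comp_continuous W `<=` preimU mor_comp_continuous U) (s : sec U) :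
  pull_comp W (res h s) = res h' (pull_comp U s).
Proof.
rewrite /pull_comp /= /pullback (pull_res h (inv_im_sub g h)).
rewrite (pull_res (inv_im_sub g h) (inv_im_sub f (inv_im_sub g h))).
by rewrite !(res_comp _ _ (subset_trans h' (@inv_im_comp_sub U))).
Qed.

Lemma pull_comp_scalar (U : opens Z) (a : k) : pull_comp U (scalar U a) = scalar _ a.
Proof.
rewrite /pull_comp /= /pullback !pull_scalar /scalar.
by rewrite (res_comp _ _ (@sub_fullU _ (preimU mor_comp_continuous U))).
Qed.

Lemma pull_comp_local (U : opens Z) (s : sec U) (x : X) :
  invertible_at (pull_comp U s) x -> invertible_at s ((g \o f) x).
Proof.
move=> [W [h [Wx Winv]]]; apply: pull_local; apply: pull_local.
exists W, (subset_trans h (@inv_im_comp_sub U)); split=> //.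
by move: Winv; rewrite /pull_comp /= (res_comp _ _ (subset_trans h (@inv_im_comp_sub U))).
Qed.

Definition mor_comp : morphism X Z := Morphism pull_comp_res pull_comp_scalar pull_comp_local.

End Composition.

Definition affine_morphism (k : fieldType) (X Y : scheme k)
  (f : morphism X Y) : Prop :=
  forall U : opens Y, affine_open U -> affine_open (inv_im f U).

Definition closed_immersion (k : fieldType) (X Y : scheme k)
  (f : morphism X Y) : Prop :=
  affine_morphism f /\
  forall U : opens Y, affine_open U -> forall s, exists t, pullback f U t = s.

Definition integral_scheme (k : fieldType) (X : scheme k) : Prop :=
  (exists x : X, True) /\
  forall U : opens X, (exists x, U x) ->
    (1 : sec U) <> 0 /\ forall s t : sec U, s * t = 0 -> s = 0 \/ t = 0.

(* P is the projective space over k of dimension n: D i is the chart where    *)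
(* the homogeneous coordinate z_i is invertible and t i j is z_j / z_i.       *)
Definition is_projective_space (k : fieldType) (n : nat) (P : scheme k) : Prop :=
  exists (D : 'I_n.+1 -> opens P) (t : forall i, 'I_n.+1 -> sec (D i)),
  [/\ forall x : P, exists i, D i x,
      forall i, affine_open (D i) /\
        polynomial_algebra (scalar (D i)) [tuple t i (lift i l) | l < n],
      forall i, t i i = 1,
      forall i j, D i `&` D j = nonvanishing (t i j) &
      forall (i j l : 'I_n.+1) (W : opens P) (hi : W `<=` D i) (hj : W `<=` D j),
        res hi (t i l) = res hi (t i j) * res hj (t j l)].

Definition projective_scheme (k : fieldType) (X : scheme k) : Prop :=
  exists (n : nat) (P : scheme k) (f : morphism X P),
    is_projective_space n P /\ closed_immersion f.

Definition smooth_at (k : fieldType) (X : scheme k) (d : nat) (x : X) : Prop :=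
  exists U : opens X,
    [/\ U x, affine_open U & standard_smooth (scalar U) d].

Definition smooth_scheme (k : fieldType) (X : scheme k) : Prop :=
  forall x : X, exists d, smooth_at d x.

Definition smooth_projective_curve (k : fieldType) (X : scheme k) : Prop :=
  [/\ integral_scheme X, projective_scheme X & forall x : X, smooth_at 1 x].

Record module_sheaf (k : fieldType) (X : ringed_space k) := ModuleSheaf {
  msec :> forall U : opens X, lmodType (sec U);
  mres : forall U W : opens X, W `<=` U -> {additive msec U -> msec W};
  mresZ : forall (U W : opens X) (h : W `<=` U) (a : sec U) (v : msec U),
    mres h (a *: v) = res h a *: mres h v;
  mres_id : forall (U : opens X) (h : U `<=` U) (v : msec U), mres h v = v;
  mres_comp : forall (U W Z : opens X) (h : W `<=` U) (h' : Z `<=` W)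
    (h'' : Z `<=` U) (v : msec U), mres h' (mres h v) = mres h'' v;
  msec_separated : forall (I : Type) (U : opens X) (C : I -> opens X)
    (h : forall i, C i `<=` U) (v : msec U), open_set U = \bigcup_i C i ->
    (forall i, mres (h i) v = 0) -> v = 0;
  msec_glue : forall (I : Type) (U : opens X) (C : I -> opens X)
    (h : forall i, C i `<=` U) (v : forall i, msec (C i)),
    open_set U = \bigcup_i C i ->
    (forall (i j : I) (W : opens X) (hi : W `<=` C i) (hj : W `<=` C j),
       mres hi (v i) = mres hj (v j)) ->
    exists w : msec U, forall i, mres (h i) w = v i }.

Arguments mres {k X} m {U W} h.

Definition frame (k : fieldType) (X : ringed_space k) (V : module_sheaf X)
    (U : opens X) n (e : n.-tuple (V U)) : Prop :=
  forall (W : opens X) (h : W `<=` U) (v : V W),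
    exists! a : n.-tuple (sec W), v = \sum_(i < n) tnth a i *: mres V h (tnth e i).

Record vector_bundle (k : fieldType) (X : ringed_space k) (n : nat) := VectorBundle {
  vb_sheaf :> module_sheaf X;
  vb_locally_free : forall x : X, exists (U : opens X) (e : n.-tuple (vb_sheaf U)),
    U x /\ frame e }.

(* The symmetric square of V, with its universal symmetric bilinear product:  *)
(* it is determined up to unique isomorphism by the requirement that          *)
(* v1^2, v2^2, v1 v2 be a frame whenever v1, v2 is one.                       *)
Record sym_square (k : fieldType) (X : ringed_space k) (V : vector_bundle X 2) :=
SymSquare {
  sym_sheaf :> module_sheaf X;
  sprod : forall U : opens X, V U -> V U -> sym_sheaf U;
  sprodC : forall (U : opens X) (v w : V U), sprod v w = sprod w v;
  sprodDl : forall (U : opens X) (v v' w : V U),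
    sprod (v + v') w = sprod v w + sprod v' w;
  sprodZl : forall (U : opens X) (a : sec U) (v w : V U),
    sprod (a *: v) w = a *: sprod v w;
  sprod_res : forall (U W : opens X) (h : W `<=` U) (v w : V U),
    mres sym_sheaf h (sprod v w) = sprod (mres V h v) (mres V h w);
  sprod_frame : forall (U : opens X) (v1 v2 : V U),
    frame [tuple v1; v2] -> frame [tuple sprod v1 v1; sprod v2 v2; sprod v1 v2] }.

Arguments sprod {k X V} s {U} v w.

Section HitchinBase.
Variables (k : fieldType) (X : scheme k) (V : vector_bundle X 2).
Variable S : sym_square V.

(* b = b1 v1^2 + b2 v2^2 + 2 b3 v1 v2 over U. *)
Definition components (b : S (fullU X)) (U : opens X) (v1 v2 : V U)
    (b1 b2 b3 : sec U) : Prop :=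
  frame [tuple v1; v2] /\
  mres S (@sub_fullU _ U) b =
    b1 *: sprod S v1 v1 + b2 *: sprod S v2 v2 + (b3 *+ 2) *: sprod S v1 v2.

Definition hitchin_base : set (S (fullU X)) :=
  [set b | forall (U : opens X) (v1 v2 : V U) (b1 b2 b3 : sec U),
     components b v1 v2 b1 b2 b3 -> b3 ^+ 2 = b1 * b2].

Definition section_vanishes_to_order (n : nat) (b : S (fullU X)) (x : X) : Prop :=
  exists (U : opens X) (v1 v2 : V U) (b1 b2 b3 : sec U),
    [/\ U x, components b v1 v2 b1 b2 b3, vanishes_to_order n b1 x,
        vanishes_to_order n b2 x & vanishes_to_order n b3 x].

Definition hitchin_base' : set (S (fullU X)) :=
  [set b | hitchin_base b /\
     exists eta : X, generic_point eta /\ ~ section_vanishes_to_order 1 b eta].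

Definition multiple_zero (b : S (fullU X)) (x : X) : Prop :=
  section_vanishes_to_order 2 b x.

End HitchinBase.

(* The total space of V. A frame v1, v2 over U gives the fibre coordinates    *)
(* X = fst (coord v1 v2) and Y = snd (coord v1 v2) of the point X v1 + Y v2.  *)
(* The law ts_coord_change expresses that this point does not depend on the   *)
(* frame, and includes the compatibility with restriction.                    *)
Record total_space (k : fieldType) (X : scheme k) (V : vector_bundle X 2) :=
TotalSpace {
  ts_scheme :> scheme k;
  ts_proj : morphism ts_scheme X;
  ts_affine : affine_morphism ts_proj;
  coord : forall U : opens X, V U -> V U ->
    sec (inv_im ts_proj U) * sec (inv_im ts_proj U);
  ts_coord_change : forall (U W : opens X) (h : W `<=` U) (v1 v2 : V U)
    (w1 w2 : V W) (a11 a12 a21 a22 : sec W),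
    frame [tuple v1; v2] -> frame [tuple w1; w2] ->
    w1 = a11 *: mres V h v1 + a21 *: mres V h v2 ->
    w2 = a12 *: mres V h v1 + a22 *: mres V h v2 ->
    res (inv_im_sub ts_proj h) (coord v1 v2).1 =
      pullback ts_proj W a11 * (coord w1 w2).1 +
      pullback ts_proj W a12 * (coord w1 w2).2 /\
    res (inv_im_sub ts_proj h) (coord v1 v2).2 =
      pullback ts_proj W a21 * (coord w1 w2).1 +
      pullback ts_proj W a22 * (coord w1 w2).2;
  ts_polynomial : forall (U : opens X) (v1 v2 : V U),
    affine_open U -> frame [tuple v1; v2] ->
    polynomial_algebra (pullback ts_proj U)
      [tuple (coord v1 v2).1; (coord v1 v2).2] }.

Arguments coord {k X V} t {U} v1 v2.

(* The closed subscheme of the total space cut out locally by the ideal       *)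
(* (X^2 - b1, Y^2 - b2, X Y - b3).                                            *)
Record spectral_curve (k : fieldType) (X : scheme k) (V : vector_bundle X 2)
    (S : sym_square V) (E : total_space V) (b : S (fullU X)) := SpectralCurve {
  sc_scheme :> scheme k;
  sc_incl : morphism sc_scheme E;
  sc_closed : closed_immersion sc_incl;
  sc_ideal : forall (U : opens X) (v1 v2 : V U) (b1 b2 b3 : sec U),
    affine_open U -> components b v1 v2 b1 b2 b3 ->
    let x := (coord E v1 v2).1 in
    let y := (coord E v1 v2).2 in
    let p := pullback (ts_proj E) U in
    forall f : sec (inv_im (ts_proj E) U),
      pullback sc_incl _ f = 0 <->
      exists q1 q2 q3, f = q1 * (x ^+ 2 - p b1) + q2 * (y ^+ 2 - p b2)
                         + q3 * (x * y - p b3) }.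

Definition sc_proj (k : fieldType) (X : scheme k) (V : vector_bundle X 2)
  (S : sym_square V) (E : total_space V) (b : S (fullU X))
  (Y : spectral_curve E b) : morphism Y X := mor_comp (ts_proj E) (sc_incl Y).

(* The torsion subsheaf of pi_* O_Y, for X integral. *)
Definition torsion_section (k : fieldType) (X Y : scheme k) (pi : morphism Y X)
    (U : opens X) (s : sec (inv_im pi U)) : Prop :=
  forall x, U x -> exists (W : opens X) (h : W `<=` U) (a : sec W),
    [/\ W x, a <> 0 & pullback pi W a * res (inv_im_sub pi h) s = 0].

(* The closed subscheme Spec (pi_* O_Y / T) of Y, where T is the torsion of   *)
(* pi_* O_Y.                                                                  *)
Record modification (k : fieldType) (X Y : scheme k) (pi : morphism Y X) :=
Modification {
  mod_scheme :> scheme k;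
  mod_incl : morphism mod_scheme Y;
  mod_closed : closed_immersion mod_incl;
  mod_ideal : forall (U : opens X) (s : sec (inv_im pi U)), affine_open U ->
    pullback mod_incl _ s = 0 <-> torsion_section s }.

(* Main.v *)
(* Every point of a curve specializes to a closed point, so by the            *)
(* Nullstellensatz it suffices to work near points p of X with residue field  *)
(* k. If b1 is, up to exchanging b1 and b2, a unit or a local parameter at p, *)
(* then b3 = c b1 near p, the difference y - c x is torsion, and the          *)
(* modification is the double cover x^2 = b1, which is smooth. If neither b1  *)
(* nor b2 is, then b1 and b2 vanish to order 2 and so does b3, as             *)
(* b3^2 = b1 b2.                                                              *)
(* Conversely let b_i = t^2 b_i' at p, with t a local parameter, and suppose  *)
(* that the modification is smooth at the point q given by x = y = t = 0. The *)
(* tangent cone at q is then a domain; hence x^2 = b1' t^2 puts x in          *)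
(* k t + m_q^2, and likewise y. By Nakayama m_q = (t), so x and y are         *)
(* divisible by t near q. As the modification is O + O x + O y near p, with O *)
(* meeting O x + O y trivially, this forces x = y = 0 near p, and b = 0.      *)

Require Import Defs.
From HB Require Import structures.
From mathcomp Require Import all_boot all_order all_algebra.
From mathcomp Require Import all_classical all_reals topology.
From mathcomp Require Import complex ring.
From mathcomp Require Import -(notations) mpoly.

Set Implicit Arguments.
Unset Strict Implicit.
Unset Printing Implicit Defensive.

Import GRing.Theory Num.Theory.
Local Open Scope classical_set_scope.
Local Open Scope ring_scope.

(** Over an affine open of [X] with ring [A] and a frame of [V], the modification is affine with
    ring [B], described by [spectral_algebra] and established in [spectral_algebra_over]: [B] is
    spanned over [A] by 1, [x], [y], with [x^2 = b1], [y^2 = b2], [x y = b3]; it has no [A]-torsion;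
    and a relation between 1, [x], [y] has zero constant term. The last property rests on
    [b3^2 = b1 b2] ([spectral_ideal_const]). By the Nullstellensatz every point specializes to a
    rational one ([affine_rational_specialization]), so the work takes place at rational points,
    with maximal ideal [m] the kernel of an evaluation.

    No multiple zero implies smooth. If [b1] and [b2] both lie in [m^2], then so does [b3], because
    the tangent cone at a smooth point is a domain ([tangent_cone_domain]), and the point is a
    multiple zero. So one of them, say [g], is a unit or a local parameter. Near the point [g]
    divides [b3], torsion-freeness makes one fibre coordinate a multiple of the other, and [B]
    becomes [A + A z] with [z^2 = g]. Its Jacobian is explicit ([standard_smooth_spectral]): for a
    unit, [2 z] is invertible; for a parameter, [z] becomes the free coordinate.

    Smooth implies no multiple zero. At a multiple zero all [b_i] are divisible by [t^2], with [t] a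
    parameter. The tangent cone at [x = y = t = 0] being a domain, [x^2 - r^2 t^2] in [m^3] puts one
    of [x - r t], [x + r t] in [m^2], and similarly for [y]. By [nakayama], [t] divides [x] and [y]
    up to a unit, and comparison with the module structure forces [x = y = 0], hence [b1 = b2 = 0],
    against [components_nonzero] ([multiple_zero_not_smooth], [multiple_zero_singular]). *)

Local Notation mvar k i := (mpolyX k (mnm1 i)).
(* The name is shadowed by the linear forms of ssralg. *)
Local Notation scalar := (@Defs.scalar _ _).

(* mpoly.mmap is only available over nonzero rings. *)
Lemma comPzRing_nontrivial (B : comPzRingType) : (1 : B) <> 0 ->
  exists B' : comNzRingType, (B' : comPzRingType) = B.
Proof.
move=> B10; have B1 : GRing.PzSemiRing_isNonZero B.
  by constructor; apply/eqP.
exists (GRing.ComNzRing.Pack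
  (@GRing.ComNzRing.Class _ _ _ _ (GRing.ComPzRing.Algebra_BaseZmoduleNmodule_isZmodule_mixin (GRing.ComPzRing.class B))
    _ _ _ _ _ _ B1
  (GRing.ComPzRing.GRing_PzSemiRing_hasCommutativeMul_mixin (GRing.ComPzRing.class B)))).
by case: B B10 B1.
Qed.

Lemma rmorphism_of_morph (R S : comPzRingType) (f : R -> S) :
  {morph f : u v / u - v} -> {morph f : u v / u * v} -> f 1 = 1 ->
  exists g : {rmorphism R -> S}, g =1 f.
Proof.
move=> fB fM f1.
pose g0 : {additive R -> S} := HB.pack f (GRing.isZmodMorphism.Build _ _ f fB).
pose g : {rmorphism R -> S} := HB.pack f (GRing.isZmodMorphism.Build _ _ f fB)
   (GRing.isMonoidMorphism.Build _ _ f (conj f1 fM)).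
by exists g.
Qed.

(** * Evaluation of multivariate polynomials *)

Lemma mpoly_ring_ind n (k : fieldType) (P : mpoly n k -> Prop) :
  (forall c, P (mpolyC n c)) -> (forall i, P (mvar k i)) ->
  (forall p q, P p -> P q -> P (p + q)) -> (forall p q, P p -> P q -> P (p * q)) ->
  forall p, P p.
Proof.
move=> PC PX PD PM p; elim/mpolyind: p => [|c m p _ _ Pp].
  by have := PC 0; rewrite mpolyC0.
apply: PD => //; rewrite -mul_mpolyC; apply: (PM) => //.
rewrite mpolyXE_id; apply: big_ind => [||i _]; [|exact: (PM)|].
  by have := PC 1; rewrite mpolyC1.
elim: (m i) => [|e IH]; first by have := PC 1; rewrite mpolyC1 expr0.
by rewrite exprS; apply: (PM).
Qed.

Lemma mpoly_rmorph_eq n (k : fieldType) (B : comPzRingType)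
    (f g : {rmorphism mpoly n k -> B}) :
  (forall c, f (mpolyC n c) = g (mpolyC n c)) ->
  (forall i, f (mvar k i) = g (mvar k i)) -> f =1 g.
Proof.
move=> eC eX; apply: mpoly_ring_ind => // p q ep eq; first by rewrite !rmorphD ep eq.
by rewrite !rmorphM ep eq.
Qed.

Section MpEval.
Variables (k : fieldType) (B : comPzRingType) (phi : {rmorphism k -> B}).
Variables (n : nat) (x : n.-tuple B).

Lemma mpeval_facts :
  [/\ {morph mpeval phi x : p q / p - q}, {morph mpeval phi x : p q / p * q},
      mpeval phi x 1 = 1, forall c, mpeval phi x (mpolyC n c) = phi c &
      forall i, mpeval phi x (mvar k i) = tnth x i].
Proof.
have [e|/comPzRing_nontrivial[B' eB]] := pselect ((1 : B) = 0).
  have z (a c : B) : a = c by rewrite -[a]mul1r -[c]mul1r e !mul0r.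
  by split=> [u v|u v||c|i]; apply: z.
(* Over a nonzero ring [mpeval] is convertible to [mmap], whose laws apply; over the zero ring all
   equations hold. *)
subst B; have E p : mpeval phi x p = mmap phi (tnth x) p by [].
by split=> [u v|u v||c|i]; rewrite !E ?rmorphB ?rmorphM ?rmorph1 ?mmapC ?mmapX ?mmap1U.
Qed.

Lemma mpeval_zmod_morphism : zmod_morphism (mpeval phi x).
Proof. by have [] := mpeval_facts. Qed.

Lemma mpeval_monoid_morphism : monoid_morphism (mpeval phi x).
Proof. by have [_ ? ?] := mpeval_facts. Qed.

HB.instance Definition _ :=
  GRing.isZmodMorphism.Build (mpoly n k) B (mpeval phi x) mpeval_zmod_morphism.
HB.instance Definition _ :=
  GRing.isMonoidMorphism.Build (mpoly n k) B (mpeval phi x) mpeval_monoid_morphism.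

Lemma mpevalC c : mpeval phi x (mpolyC n c) = phi c.
Proof. by have [_ _ _ ->] := mpeval_facts. Qed.

Lemma mpevalX i : mpeval phi x (mvar k i) = tnth x i.
Proof. by have [_ _ _ _ ->] := mpeval_facts. Qed.

End MpEval.

Lemma mpeval_rmorph (k : fieldType) (B C : comPzRingType) (phi : {rmorphism k -> B})
    (phi' : {rmorphism k -> C}) (psi : {rmorphism B -> C}) n (x : n.-tuple B)
    (y : n.-tuple C) :
  psi \o phi =1 phi' -> (forall i, tnth y i = psi (tnth x i)) ->
  forall p, psi (mpeval phi x p) = mpeval phi' y p.
Proof.
move=> e ey; apply: (mpoly_rmorph_eq (f := psi \o mpeval phi x) (g := mpeval phi' y)).
  by move=> c /=; rewrite !mpevalC -e.
by move=> i /=; rewrite !mpevalX ey.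
Qed.

Section Rename.
Variables (k : fieldType) (n N : nat) (iota : 'I_n -> 'I_N).

Definition ren : mpoly n k -> mpoly N k :=
  mpeval (@mpolyC N k) [tuple mvar k (iota i) | i < n].

HB.instance Definition _ := GRing.RMorphism.on ren.

Lemma renC c : ren (mpolyC n c) = mpolyC N c.
Proof. exact: mpevalC. Qed.

Lemma renX i : ren (mvar k i) = mvar k (iota i).
Proof. by rewrite /ren mpevalX tnth_mktuple. Qed.

Lemma mpeval_ren (B : comPzRingType) (phi : {rmorphism k -> B}) (x : n.-tuple B)
    (y : N.-tuple B) : (forall i, tnth y (iota i) = tnth x i) ->
  forall p, mpeval phi y (ren p) = mpeval phi x p.
Proof.
move=> e; apply: (mpoly_rmorph_eq (f := mpeval phi y \o ren) (g := mpeval phi x)).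
  by move=> c /=; rewrite renC !mpevalC.
by move=> i /=; rewrite renX !mpevalX e.
Qed.

Lemma mderiv_mvar m (i j : 'I_m) : mderiv j (mvar k i) = (i == j)%:R.
Proof.
rewrite mderivX mnm1E; case: eqP => [->|_]; last by rewrite scale0r.
by rewrite scale1r -mpolyX0; congr mpolyX; apply/mnmP => l; rewrite mnmBE subnn mnm0E.
Qed.

Lemma mderiv_ren_notin j : (forall i, j <> iota i) ->
  forall p, mderiv j (ren p) = 0.
Proof.
move=> nj; apply: mpoly_ring_ind => [c|i|p q ep eq|p q ep eq].
- by rewrite renC mderivC.
- by rewrite renX mderiv_mvar; case: eqP => // /esym /nj.
- by rewrite rmorphD linearD /= ep eq addr0.
- by rewrite rmorphM /= mderivM ep eq mul0r mulr0 addr0.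
Qed.

Lemma mderiv_ren i : injective iota ->
  forall p, mderiv (iota i) (ren p) = ren (mderiv i p).
Proof.
move=> inj; apply: mpoly_ring_ind => [c|j|p q ep eq|p q ep eq].
- by rewrite renC !mderivC rmorph0.
- by rewrite renX !mderiv_mvar (inj_eq inj) rmorph_nat.
- by rewrite rmorphD !linearD /= ep eq rmorphD.
- by rewrite rmorphM /= !mderivM ep eq rmorphD !rmorphM.
Qed.

(** Singling out one variable allows induction on the number of variables and division by a
    polynomial monic in that variable. *)
Lemma mpoly_as_poly (v : 'I_N) : (forall j, j = v \/ exists i, j = iota i) ->
  forall p, exists q : {poly mpoly n k}, p = (map_poly ren q).[mvar k v].
Proof.
move=> vi; apply: mpoly_ring_ind => [c|j|p q [p' ->] [q' ->]|p q [p' ->] [q' ->]].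
- by exists (mpolyC n c)%:P; rewrite map_polyC /= renC hornerC.
- case: (vi j) => [->|[i ->]]; first by exists 'X; rewrite map_polyX hornerX.
  by exists (mvar k i)%:P; rewrite map_polyC /= renX hornerC.
- by exists (p' + q'); rewrite rmorphD hornerD.
- by exists (p' * q'); rewrite rmorphM hornerM.
Qed.

End Rename.

Arguments ren k {n N} iota p.

(** * The square of a finitely generated ideal, and Taylor expansion to first order *)

Definition ideal2 (B : comPzRingType) n (h : 'I_n -> B) (s : B) : Prop :=
  exists r : 'I_n -> 'I_n -> B, s = \sum_i \sum_j r i j * h i * h j.

Section Ideal2.
Variables (B : comPzRingType) (n : nat) (h : 'I_n -> B).

Lemma ideal2_0 : ideal2 h 0.
Proof. by exists (fun _ _ => 0); rewrite big1 // => i _; rewrite big1 // => j _; rewrite !mul0r. Qed.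

Lemma ideal2D s t : ideal2 h s -> ideal2 h t -> ideal2 h (s + t).
Proof.
move=> [r ->] [r' ->]; exists (fun i j => r i j + r' i j).
rewrite -big_split; apply: eq_bigr => i _; rewrite -big_split; apply: eq_bigr => j _ /=.
by rewrite !mulrDl.
Qed.

Lemma ideal2M s t : ideal2 h s -> ideal2 h (t * s).
Proof.
move=> [r ->]; exists (fun i j => t * r i j).
rewrite big_distrr; apply: eq_bigr => i _; rewrite big_distrr; apply: eq_bigr => j _ /=.
by rewrite !mulrA.
Qed.

Lemma ideal2_lin (c d : 'I_n -> B) :
  ideal2 h ((\sum_i c i * h i) * (\sum_j d j * h j)).
Proof.
exists (fun i j => c i * d j); rewrite big_distrl; apply: eq_bigr => i _ /=.
by rewrite big_distrr; apply: eq_bigr => j _ /=; ring.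
Qed.

End Ideal2.

Lemma mpeval_taylor (k : fieldType) (B : comPzRingType) (phi : {rmorphism k -> B}) n
    (x a : n.-tuple B) (p : mpoly n k) :
  let h i := tnth x i - tnth a i in
  exists2 r, ideal2 h r &
    mpeval phi x p = mpeval phi a p + \sum_i mpeval phi a (mderiv i p) * h i + r.
Proof.
move=> h; elim/mpoly_ring_ind: p => [c|j|p q [r ir ep] [s is' eq]|p q [r ir ep] [s is' eq]].
- exists 0; first exact: ideal2_0.
  rewrite !mpevalC big1 ?addr0 // => i _.
  by rewrite mderivC rmorph0 mul0r.
- exists 0; first exact: ideal2_0.
  rewrite !mpevalX (bigD1 j) //= mderiv_mvar eqxx rmorph1 mul1r.
  rewrite big1 => [|i /negPf]; last by rewrite mderiv_mvar eq_sym => ->; rewrite rmorph0 mul0r.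
  by rewrite /h; ring.
- exists (r + s); first exact: ideal2D.
  rewrite !rmorphD /= ep eq.
  under [X in _ = _ + X + _]eq_bigr do rewrite linearD /= rmorphD mulrDl.
  by rewrite big_split /=; ring.
- set P := mpeval phi a p in ep *; set Q := mpeval phi a q in eq *.
  set dp := \sum_i _ in ep; set dq := \sum_i _ in eq.
  (* What remains of [(P + dp + r) * (Q + dq + s)] after removing [P * Q] and the Leibniz terms
     [Q * dp + P * dq]. *)
  exists (dp * dq + (P + dp + r) * s + (Q + dq) * r).
    by do 2![apply: ideal2D; last exact: ideal2M]; apply: ideal2_lin.
  rewrite !rmorphM /= ep eq -/P -/Q.
  have -> : \sum_i mpeval phi a (mderiv i (p * q)) * h i = Q * dp + P * dq.
    rewrite /dp /dq !big_distrr -big_split; apply: eq_bigr => i _ /=.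
    by rewrite mderivM rmorphD !rmorphM /= -/P -/Q; ring.
  by ring.
Qed.

(** * The Nullstellensatz *)

Section Prime.
Variables (A : comPzRingType) (P : set A) (Pp : prime_ideal P).

Lemma prime0 : P 0. Proof. by case: Pp. Qed.
Lemma primeD f g : P f -> P g -> P (f + g). Proof. by case: Pp => _ + _ _ _; apply. Qed.
Lemma primeMl f g : P g -> P (f * g). Proof. by case: Pp => _ _ + _ _; apply. Qed.
Lemma primeMr f g : P f -> P (f * g). Proof. by rewrite mulrC; apply: primeMl. Qed.
Lemma prime1 : ~ P 1. Proof. by case: Pp. Qed.
Lemma primeM f g : P (f * g) -> P f \/ P g. Proof. by case: Pp => _ _ _ _; apply. Qed.
Lemma primeN f : P f -> P (- f). Proof. by rewrite -mulN1r; apply: primeMl. Qed.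
Lemma primeB f g : P f -> P g -> P (f - g). Proof. by move=> Pf /primeN; apply: primeD. Qed.
Lemma primeBl f g : P g -> P (f - g) -> P f.
Proof. by move=> Pg Pfg; rewrite -(subrK g f); apply: primeD. Qed.
Lemma primeX f n : P (f ^+ n) -> P f.
Proof. by elim: n => [/prime1//|n IH]; rewrite exprS => /primeM []. Qed.
Lemma prime_sum (I : Type) (r : seq I) (F : I -> A) :
  (forall i, P (F i)) -> P (\sum_(i <- r) F i).
Proof. by move=> PF; apply: big_ind => // [|f g]; [exact: prime0|exact: primeD]. Qed.

End Prime.

Lemma prime_preimage (A B : comPzRingType) (f : {rmorphism A -> B}) (P : set B) :
  prime_ideal P -> prime_ideal (f @^-1` P).
Proof.
move=> Pp; split=> /= [|u v|u v||u v].
- by rewrite rmorph0; apply: prime0.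
- by rewrite rmorphD; apply: primeD.
- by rewrite rmorphM; apply: primeMl.
- by rewrite rmorph1; apply: prime1.
- by rewrite rmorphM; apply: primeM.
Qed.

Lemma prime_kernel (A : comPzRingType) (k : fieldType) (f : {rmorphism A -> k}) :
  prime_ideal [set s | f s = 0].
Proof.
split=> /= [|u v|u v||u v].
- by rewrite rmorph0.
- by rewrite rmorphD => -> ->; rewrite addr0.
- by rewrite rmorphM => ->; rewrite mulr0.
- by rewrite rmorph1; apply/eqP; rewrite oner_eq0.
- by rewrite rmorphM => /eqP; rewrite mulf_eq0 => /orP[] /eqP; [left|right].
Qed.

Lemma rmorph_factor (R A B : comPzRingType) (p : {rmorphism R -> A}) (f : {rmorphism R -> B}) :
  (forall a, exists r, p r = a) -> (forall r, p r = 0 -> f r = 0) ->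
  exists g : {rmorphism A -> B}, forall r, g (p r) = f r.
Proof.
move=> /choice[s ps] kf.
have gE r : f (s (p r)) = f r.
  by apply/eqP; rewrite -subr_eq0 -rmorphB; apply/eqP/kf; rewrite rmorphB ps subrr.
have [u v|u v||g eg] := @rmorphism_of_morph A B (f \o s) => /=.
- by rewrite -[in LHS](ps u) -[in LHS](ps v) -rmorphB gE rmorphB.
- by rewrite -[in LHS](ps u) -[in LHS](ps v) -rmorphM gE rmorphM.
- by rewrite -(rmorph1 p) gE rmorph1.
by exists g => r; rewrite eg /= gE.
Qed.

(* [iota : k -> R] has enough k-points to separate the complement of a prime. *)
Definition nullstellensatz (k : fieldType) (R : comPzRingType) (iota : k -> R) : Prop :=
  forall (P : set R) (beta : R), prime_ideal P -> ~ P beta ->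
  exists phi : {rmorphism R -> k},
    [/\ forall a, phi (iota a) = a, forall s, P s -> phi s = 0 & phi beta <> 0].

Lemma nullstellensatz_field (k : fieldType) : nullstellensatz (@idfun k).
Proof.
move=> P beta Pp nPb; exists idfun; split=> // [s Ps|b0]; last by apply: nPb; rewrite (b0 : beta = 0); apply: prime0.
apply/eqP/negPn/negP => s0; apply: (prime1 Pp).
by rewrite -(mulVf s0); apply: primeMl.
Qed.

Lemma nullstellensatz_surj (k : fieldType) (R A : comPzRingType) (iota : k -> R)
    (f : {rmorphism R -> A}) :
  (forall a, exists r, f r = a) -> nullstellensatz iota -> nullstellensatz (f \o iota).
Proof.
move=> fs NR P beta Pp nPb; have [r er] := fs beta.
have [|phi [ph1 ph2 ph3]] := NR _ r (prime_preimage f Pp); first by rewrite /= er.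
have [|psi epsi] := rmorph_factor (p := f) (f := phi) fs.
  by move=> s fs0; apply: ph2; rewrite /= fs0; apply: prime0.
exists psi; split=> [a|s|]; rewrite -?er /= ?epsi //.
by have [s' <-] := fs s => Ps; rewrite epsi ph2.
Qed.

(** Each division step costs one factor [lead_coef e], so no inverse of it is required. The bound on
    the quotient later contradicts a minimal degree. *)
Lemma pseudo_division (R : comNzRingType) (e p : {poly R}) : e != 0 ->
  exists (N : nat) (q r : {poly R}), [/\ lead_coef e ^+ N *: p = q * e + r,
    (size r < size e)%N & (size q <= (size p).+1 - size e)%N].
Proof.
move=> e0; have [n] := ubnP (size p); elim: n p => // n IH p /ltnSE sp.
have [lt|le] := ltnP (size p) (size e).
  by exists 0, 0, p; rewrite expr0 scale1r mul0r add0r size_poly0.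
have p0 : p != 0 by rewrite -size_poly_gt0 (leq_trans _ le) // size_poly_gt0.
pose d := (size p - size e)%N.
pose p' := lead_coef e *: p - lead_coef p *: (e * 'X^d).
have sXe : size (e * 'X^d) = size p by rewrite size_mulXn // subnK.
have sp' : (size p' < size p)%N.
  rewrite -[X in (_ < X)%N]prednK ?size_poly_gt0 // ltnS.
  apply/leq_sizeP => j; rewrite leq_eqVlt => /orP[/eqP<-|lj].
    rewrite coefB !coefZ -/(lead_coef p) coefMXn ifF; last first.
      by apply/negbTE; rewrite -leqNgt /d -subn1 leq_sub2l // size_poly_gt0.
    have -> : ((size p).-1 - d = (size e).-1)%N.
      by rewrite /d -subn1 subnAC subKn // subn1.
    by rewrite mulrC subrr.
  have {}lj : (size p <= j)%N by rewrite -[size p]prednK ?size_poly_gt0.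
  by rewrite coefB !coefZ !nth_default ?sXe // !mulr0 subrr.
have [N [q [r [E sr sq]]]] := IH _ (leq_trans sp' sp).
exists N.+1, (q + lead_coef e ^+ N *: (lead_coef p *: 'X^d)), r; split=> //.
  have : lead_coef e *: p = p' + lead_coef p *: (e * 'X^d) by rewrite subrK.
  rewrite exprSr -scalerA => ->; rewrite scalerDr E.
  by rewrite mulrDl -!scalerAl [e * _]mulrC addrAC.
rewrite (leq_trans (size_polyD _ _)) // geq_max; apply/andP; split.
  by rewrite (leq_trans sq) // leq_sub2r // ltnW.
rewrite (leq_trans (size_scale_leq _ _)) // (leq_trans (size_scale_leq _ _)) //.
by rewrite size_polyXn /d subSn.
Qed.

Lemma nat_argmin (T : Type) (m : T -> nat) (P : T -> Prop) : (exists t, P t) ->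
  exists2 t, P t & forall u, (m u < m t)%N -> ~ P u.
Proof.
move=> [t]; have [n] := ubnP (m t); elim: n t => // n IH t /ltnSE le Pt.
have [[u [lu Pu]]|no] := pselect (exists u, (m u < m t)%N /\ P u).
  by apply: (IH u) => //; apply: leq_trans lu le.
by exists t => // u lu Pu; apply: no; exists u.
Qed.

(** * The Nullstellensatz passes from a ring to its polynomial ring in one variable *)

Section NullstellensatzPoly.
Variables (k : closedFieldType) (R : comNzRingType) (iota : k -> R).
Hypothesis NR : nullstellensatz iota.
Variables (P : set {poly R}) (beta : {poly R}).
Hypotheses (Pp : prime_ideal P) (nPb : ~ P beta).

Let P0 : set R := [set r | P r%:P].
(** Membership in the extension to [{poly R}] of the contracted prime [P0]. *)
Let small (q : {poly R}) := forall i, P0 q`_i.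

Let P0p : prime_ideal P0.
Proof. exact: (prime_preimage polyC Pp). Qed.

Let small_P q : small q -> P q.
Proof.
move=> sq; rewrite -[q]coefK poly_def; apply: prime_sum => // i.
by rewrite -mul_polyC; apply: primeMr => //; apply: sq.
Qed.

(** If the leading coefficient were in [P0], removing the leading term would give a shorter element
    of [Q] that is still not [small]. *)
Let minimal_lead (Q : set {poly R}) (e : {poly R}) :
    (forall q r, Q q -> P r -> Q (q - r)) -> Q e -> ~ small e ->
    (forall u : {poly R}, (size u < size e)%N -> ~ (Q u /\ ~ small u)) -> ~ P0 (lead_coef e).
Proof.
move=> QB Qe nse min P0e.
have e0 : e != 0 by apply/eqP => e0; apply: nse => i; rewrite e0 coef0; apply: (prime0 P0p).
pose u := e - lead_coef e *: 'X^((size e).-1).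
have su : (size u < size e)%N.
  rewrite -[X in (_ < X)%N]prednK ?size_poly_gt0 // ltnS.
  apply/leq_sizeP => j; rewrite coefB coefZ coefXn leq_eqVlt => /orP[/eqP<-|lj].
    by rewrite eqxx mulr1 subrr.
  by rewrite gtn_eqF // mulr0 subr0 nth_default // -[size e]prednK ?size_poly_gt0.
apply: (min u su); split.
  by apply: QB => //; rewrite -mul_polyC; apply: primeMr.
move=> smu; apply: nse => i; have := smu i; rewrite coefB coefZ coefXn.
by apply: primeBl => //; apply: (primeMr P0p).
Qed.

(** If [P] is extended from [P0], keep one coefficient of [beta] nonzero and evaluate at a non-root.
    Otherwise [P] contains an [f] of minimal degree that is not [small]; over the fraction field of
    [R / P0] it would generate [P], so one evaluates at a root of its image in [{poly k}].
    Pseudo-division replaces division over that field. *)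
Lemma nullstellensatz_poly_aux : exists phi : {rmorphism {poly R} -> k},
  [/\ forall a, phi (iota a)%:P = a, forall s, P s -> phi s = 0 & phi beta <> 0].
Proof.
pose ev (phi : {rmorphism R -> k}) (x : k) : {rmorphism {poly R} -> k} :=
  horner_eval x \o map_poly phi.
have evE phi x q : ev phi x q = (map_poly phi q).[x] by [].
have evC phi x r : ev phi x r%:P = phi r by rewrite evE map_polyC hornerC.
have [[f0 [Pf0 nsf0]]|allP] := pselect (exists q, P q /\ ~ small q); last first.
  have [i nPi] : exists i, ~ P0 beta`_i.
    by apply/existsNP => sb; apply: nPb; apply: small_P.
  have [phi [ph1 ph2 ph3]] := NR P0p nPi.
  have /closed_nonrootP[x] : map_poly phi beta != 0.
    by apply/eqP => /polyP/(_ i); rewrite coef_map coef0.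
  move=> nr; exists (ev phi x); split=> [a|s Ps|]; rewrite ?evC //.
    rewrite evE (_ : map_poly phi s = 0) ?horner0 //; apply/polyP => j.
    rewrite coef_map coef0; apply: ph2; apply: contrapT => nPj; apply: allP.
    by exists s; split=> // /(_ j).
  by rewrite evE; apply/eqP.
have [f [Pf nsf] minf] := nat_argmin (fun q : {poly R} => size q)
  (ex_intro (fun q => P q /\ ~ small q) f0 (conj Pf0 nsf0)).
have lf : ~ P0 (lead_coef f).
  by apply: (minimal_lead (Q := P)) minf => // q r; apply: primeB.
pose Q := [set q | exists2 p, P p & exists s, q = p + beta * s].
have PQ q : P q -> Q q by exists q => //; exists 0; rewrite mulr0 addr0.
have QB q r : Q q -> Q r -> Q (q - r).
  move=> [p Pp' [s ->]] [p' Pp'' [s' ->]]; exists (p - p'); first exact: primeB.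
  by exists (s - s'); ring.
have QM q r : Q r -> Q (q * r).
  move=> [p Pp' [s ->]]; exists (q * p); first exact: primeMl.
  by exists (q * s); ring.
have [e [Qe nse] mine] := nat_argmin (fun q : {poly R} => size q)
  (ex_intro (fun q => Q q /\ ~ small q) f (conj (PQ _ Pf) nsf)).
have le : ~ P0 (lead_coef e).
  by apply: (minimal_lead (Q := Q)) mine => // q r Qq /PQ; apply: QB.
have smallQ q : Q q -> (size q < size e)%N -> small q.
  by move=> Qq sq; apply: contrapT => nsq; apply: (mine q).
have smallP q : P q -> (size q < size f)%N -> small q.
  by move=> Pq sq; apply: contrapT => nsq; apply: (minf q).
have f0' : f != 0 by apply/eqP => f0'; apply: nsf => i; rewrite f0' coef0; apply: (prime0 P0p).
have e0 : e != 0 by apply/eqP => e0; apply: nse => i; rewrite e0 coef0; apply: (prime0 P0p).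
have sf : (1 < size f)%N.
  rewrite ltnNge; apply/negP => /size1_polyC E; apply: nsf => i.
  rewrite E coefC; case: (i == 0)%N; last exact: (prime0 P0p).
  by rewrite /P0 /= -E.
have nPl N r : ~ P0 r -> ~ P0 (r ^+ N) by move=> nr /(primeX P0p).
have PZ c q : ~ P0 c -> P (c *: q) -> P q.
  by move=> nc; rewrite -mul_polyC => /(primeM Pp) [].
(* Bézout modulo [P0]: [P + (beta)] contains a constant outside [P0]. For nonconstant [e], dividing
   [beta] by [e] shows that [e] is not in [P]; dividing [f] by [e] then puts the quotient in [P],
   too short not to be [small], so the leading coefficient of a multiple of [f] would lie in
   [P0]. *)
have se : (size e <= 1)%N.
  rewrite leqNgt; apply/negP => se.
  have nPe : ~ P e.
    move=> Pe; have [N [q [r [E sr _]]]] := pseudo_division beta e0.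
    have Qr : Q r.
      have -> : r = (lead_coef e ^+ N)%:P * beta - q * e by rewrite mul_polyC E addrAC subrr add0r.
      apply: QB; apply: QM => //.
      by exists 0; [exact: prime0|exists 1; rewrite add0r mulr1].
    apply: nPb; apply: (PZ (lead_coef e ^+ N)); first exact: nPl.
    by rewrite E; apply: primeD => //; [exact: primeMl|apply/small_P/smallQ].
  have [N [q [r [E sr sq]]]] := pseudo_division f e0.
  have sr' : small r.
    apply: smallQ => //.
    have -> : r = (lead_coef e ^+ N)%:P * f - q * e by rewrite mul_polyC E addrAC subrr add0r.
    by apply: QB; apply: QM => //; apply: PQ.
  have : P (q * e).
    have -> : q * e = (lead_coef e ^+ N)%:P * f - r by rewrite mul_polyC E addrK.
    by apply: primeB => //; [exact: primeMl|exact: small_P].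
  move=> /(primeM Pp)[Pq|//].
  have sq' : small q.
    apply: smallP => //; apply: leq_ltn_trans sq _.
    by rewrite -[size e]prednK ?(ltnW se) // subSS ltn_subrL -subn1 subn_gt0 se (ltnW sf).
  have : P0 (lead_coef e ^+ N * lead_coef f).
    rewrite -coefZ E coefD; apply: (primeD P0p) => //.
    by rewrite coefM; apply: prime_sum => // i; apply: primeMr.
  by move=> /(primeM P0p)[/nPl|].
have eE := size1_polyC se; set c := e`_0 in eE.
have nPc : ~ P0 c by move=> Pc; apply: le; rewrite eE lead_coefC.
have nPcl : ~ P0 (c * lead_coef f) by move=> /(primeM P0p)[].
have [phi [ph1 ph2 ph3]] := NR P0p nPcl.
have /eqP pl : phi (lead_coef f) <> 0 by move=> h; apply: ph3; rewrite rmorphM h mulr0.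
have phi_small q : small q -> map_poly phi q = 0.
  by move=> sq; apply/polyP => i; rewrite coef_map coef0; apply: ph2.
have /closed_rootP[x /rootP rx] : size (map_poly phi f) != 1%N.
  by rewrite size_map_poly_id0 // gtn_eqF.
have evP s : P s -> ev phi x s = 0.
  move=> Ps; have [N [q [r [E sr _]]]] := pseudo_division s f0'.
  have sr' : small r.
    apply: smallP => //.
    have -> : r = (lead_coef f ^+ N)%:P * s - q * f by rewrite mul_polyC E addrAC subrr add0r.
    by apply: primeB => //; apply: primeMl.
  have := congr1 (ev phi x) E; rewrite -mul_polyC rmorphD !rmorphM evC rmorphXn.
  rewrite [ev phi x r]evE (phi_small _ sr') horner0 addr0.
  rewrite [ev phi x f]evE rx mulr0 => /eqP; rewrite mulf_eq0 expf_eq0 (negPf pl) andbF /=.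
  by move/eqP.
exists (ev phi x); split=> [a||]; rewrite ?evC //.
(* The constant [c] has the form [p + beta * s] with [p] in [P], so a zero of [beta] would be a zero
   of [c]. *)
move=> eb; apply: ph3; rewrite rmorphM -(evC phi x c) -eE.
by have [p Pp' [s ->]] := Qe; rewrite rmorphD rmorphM evP // eb mul0r add0r mul0r.
Qed.

End NullstellensatzPoly.

Lemma nullstellensatz_poly (k : closedFieldType) (R : comNzRingType) (iota : k -> R) :
  nullstellensatz iota -> nullstellensatz (polyC \o iota).
Proof. by move=> NR P beta Pp nPb; apply: nullstellensatz_poly_aux. Qed.

Lemma nullstellensatz_mpoly (k : closedFieldType) n : nullstellensatz (@mpolyC n k).
Proof.
elim: n => [|n IH].
  apply: (nullstellensatz_surj (f := @mpolyC 0 k)) (@nullstellensatz_field k) => p.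
  by exists (mcoeff (@mnm0 0) p); apply/mpolyP => m; rewrite mcoeffC (_ : m = @mnm0 0)
    ?eqxx ?mulr1 //; apply/mnmP => -[].
pose f : {rmorphism {poly mpoly n k} -> mpoly n.+1 k} :=
  horner_eval (mvar k ord0) \o map_poly (ren k (lift ord0)).
have -> : @mpolyC n.+1 k = f \o (polyC \o @mpolyC n k).
  by apply/funext => c /=; rewrite map_polyC /= /horner_eval hornerC renC.
apply: nullstellensatz_surj; last exact: nullstellensatz_poly.
move=> p; have [|q ->] := mpoly_as_poly (iota := lift ord0) (v := ord0) _ p; last by exists q.
by move=> j; case: (unliftP ord0 j) => [i ->|->]; [right; exists i|left].
Qed.

Lemma nullstellensatz_fg (k : closedFieldType) (A : comPzRingType) (phi : {rmorphism k -> A})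
    n (x : n.-tuple A) :
  (forall s, exists p, s = mpeval phi x p) -> nullstellensatz phi.
Proof.
move=> gen; have -> : phi = mpeval phi x \o @mpolyC n k :> (k -> A).
  by apply/funext => c /=; rewrite mpevalC.
apply: nullstellensatz_surj; last exact: nullstellensatz_mpoly.
by move=> a; have [p ->] := gen a; exists p.
Qed.

(** * Cotangent spaces at rational points *)

(** For an ideal [I] this is its square: coefficients are absorbed in the factors, and the inductive
    form gives induction on the number of products. *)
Inductive ideal_sq (A : comPzRingType) (I : A -> Prop) : A -> Prop :=
| ideal_sq0 : ideal_sq I 0
| ideal_sqDM u v s : I u -> I v -> ideal_sq I s -> ideal_sq I (u * v + s).

Section IdealSq.
Variables (A : comPzRingType) (k : fieldType) (ev : {rmorphism A -> k}).
Let I (s : A) := ev s = 0.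

Lemma ideal_sqD s t : ideal_sq I s -> ideal_sq I t -> ideal_sq I (s + t).
Proof.
move=> + It; elim=> [|u v {}s Iu Iv _ IH]; first by rewrite add0r.
by rewrite -addrA; apply: ideal_sqDM.
Qed.

Lemma ideal_sqMl s t : ideal_sq I t -> ideal_sq I (s * t).
Proof.
elim=> [|u v {}t Iu Iv _ IH]; first by rewrite mulr0; constructor.
by rewrite mulrDr mulrA; apply: ideal_sqDM => //; rewrite /I rmorphM Iu mulr0.
Qed.

Lemma ideal_sqM u v : I u -> I v -> ideal_sq I (u * v).
Proof. by move=> Iu Iv; rewrite -[u * v]addr0; apply: ideal_sqDM => //; constructor. Qed.

Lemma ideal_sqN s : ideal_sq I s -> ideal_sq I (- s).
Proof. by rewrite -mulN1r; apply: ideal_sqMl. Qed.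

Lemma ideal_sq_sum (J : Type) (r : seq J) (F : J -> A) :
  (forall i, ideal_sq I (F i)) -> ideal_sq I (\sum_(i <- r) F i).
Proof. by move=> IF; apply: big_ind => //; [constructor|exact: ideal_sqD]. Qed.

Lemma ideal_sq_ideal2 n (h : 'I_n -> A) s : (forall i, I (h i)) -> ideal2 h s -> ideal_sq I s.
Proof.
move=> Ih [r ->]; apply: ideal_sq_sum => i; apply: ideal_sq_sum => j.
by rewrite -mulrA; apply: ideal_sqMl; apply: ideal_sqM.
Qed.

(** Writing the [m^2] parts as combinations of the [xi] with coefficients [r] in [m] gives
    [M xi = u w] with [M = diag(h) - r]. Multiplication by the adjugate makes each [xi] a multiple
    of [u] up to [det M], whose value at the point is the product of the values of the [h l]. *)
Lemma nakayama n (xi : 'I_n -> A) (u : A) :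
    (forall s, I s -> exists c, s = \sum_l c l * xi l) ->
    (forall l, exists h w s, [/\ ev h <> 0, h * xi l = w * u + s & ideal_sq I s]) ->
  exists2 delta, ev delta <> 0 & forall s, I s -> exists w, delta * s = w * u.
Proof.
move=> gen /choice[h /choice[w /choice[s hws]]].
have sqE t : ideal_sq I t -> exists2 r : 'I_n -> A, forall m, I (r m) & t = \sum_m r m * xi m.
  elim=> [|v v' {}t Iv /gen[c ->] _ [r Ir ->]].
    by exists (fun=> 0) => [m|]; [exact: rmorph0|rewrite big1 // => m _; rewrite mul0r].
  exists (fun m => v * c m + r m) => [m|].
    by rewrite /I rmorphD rmorphM Iv mul0r add0r Ir.
  by rewrite big_distrr -big_split; apply: eq_bigr => m _ /=; ring.
have /choice[r rP] : forall l, exists r : 'I_n -> A,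
    (forall m, I (r m)) /\ s l = \sum_m r m * xi m.
  by move=> l; have [_ _ /sqE[r]] := hws l; exists r.
pose M := \matrix_(i, j) (h i *+ (i == j) - r i j).
pose X := \col_i xi i; pose W := \col_i w i.
have MX : M *m X = W *m u%:M.
  apply/matrixP => i j; rewrite ord1 mul_mx_scalar !mxE [u * _]mulrC.
  have [_ E _] := hws i; have [_ sE] := rP i.
  under eq_bigr => l _ do rewrite !mxE mulrBl.
  rewrite sumrB -sE -[w i * u](addrK (s i)) -E; congr (_ - _).
  by rewrite (bigD1 i) //= eqxx big1 ?addr0 // => l /negPf; rewrite eq_sym => ->; rewrite mul0r.
have dX : \det M *: X = (\adj M *m W) *m u%:M.
  by rewrite -mul_scalar_mx -mul_adj_mx -mulmxA MX mulmxA.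
exists (\det M).
  rewrite -det_map_mx (_ : map_mx ev M = diag_mx (\row_i ev (h i))).
    rewrite det_diag; apply/eqP/prodf_neq0 => i _; rewrite mxE.
    by have [/eqP] := hws i.
  apply/matrixP => i j; rewrite !mxE rmorphB rmorphMn.
  by have [-> _] := rP i; rewrite subr0.
move=> t /gen[c ->]; exists (\sum_l c l * (\adj M *m W) l ord0).
rewrite big_distrr big_distrl; apply: eq_bigr => l _ /=.
have := congr1 (fun Z : 'M_(_, _) => Z l ord0) dX; rewrite mul_mx_scalar !mxE => E.
by rewrite mulrCA E; ring.
Qed.

End IdealSq.

(** * Differentials, tangent vectors and arcs at a rational point of a presented algebra *)

Definition presents (k : fieldType) (A : comPzRingType) (phi : k -> A) n m
    (x : n.-tuple A) (f : 'I_m -> mpoly n k) : Prop :=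
  (forall s, exists p, s = mpeval phi x p) /\
  (forall p, mpeval phi x p = 0 <-> exists q : 'I_m -> mpoly n k, p = \sum_i q i * f i).

Section RationalPoint.
Variables (k : fieldType) (A : comPzRingType) (phi : {rmorphism k -> A}).
Variables (n m : nat) (x : n.-tuple A) (f : 'I_m -> mpoly n k).
Hypothesis pres : presents phi x f.
Variable ev : {rmorphism A -> k}.
Hypothesis evphi : forall a, ev (phi a) = a.
Let I (s : A) := ev s = 0.

Let a : n.-tuple k := [tuple ev (tnth x i) | i < n].
Definition pval : {rmorphism mpoly n k -> k} := mpeval (@idfun k) a.

Lemma ev_mpeval p : ev (mpeval phi x p) = pval p.
Proof. by apply: mpeval_rmorph => // i; rewrite tnth_mktuple. Qed.

Definition differential (p : mpoly n k) : 'rV[k]_n := \row_i pval (mderiv i p).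
Definition jacobian : 'M[k]_(m, n) := \matrix_i differential (f i).

Lemma differentialB p q : differential (p - q) = differential p - differential q.
Proof. by apply/rowP => i; rewrite !mxE linearB rmorphB. Qed.

Lemma differential_sum (J : finType) (F : J -> mpoly n k) :
  differential (\sum_j F j) = \sum_j differential (F j).
Proof. by apply/rowP => i; rewrite summxE !mxE linear_sum rmorph_sum; apply: eq_bigr => j _; rewrite mxE. Qed.

Lemma differentialC c p : differential (mpolyC n c * p) = c *: differential p.
Proof. by apply/rowP => i; rewrite !mxE mderiv_mulC rmorphM /= [pval (mpolyC _ _)]mpevalC. Qed.

Lemma relation0 i : mpeval phi x (f i) = 0.
Proof.
apply/(pres.2 _).2; exists (fun j => (j == i)%:R).
by rewrite (bigD1 i) //= eqxx mul1r big1 ?addr0 // => j /negPf->; rewrite mul0r.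
Qed.

Lemma pval_relation i : pval (f i) = 0.
Proof. by rewrite -ev_mpeval relation0 rmorph0. Qed.

Let xi i := tnth x i - phi (tnth a i).

Let evxi i : I (xi i).
Proof. by rewrite /I /xi rmorphB evphi tnth_mktuple subrr. Qed.

Let taylor p : exists2 r, ideal2 xi r &
  mpeval phi x p = phi (pval p) + \sum_i phi (pval (mderiv i p)) * xi i + r.
Proof.
pose y := [tuple phi (tnth a i) | i < n].
have E q : mpeval phi y q = phi (pval q).
  by apply/esym/mpeval_rmorph => // i; rewrite tnth_mktuple.
have [r ir ->] := mpeval_taylor phi x y p.
have xiE : (fun i => tnth x i - tnth y i) = xi by apply/funext => i; rewrite tnth_mktuple.
exists r; first by rewrite -xiE.
by rewrite E; congr (_ + _ + _); apply: eq_bigr => i _; rewrite E tnth_mktuple.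
Qed.

Lemma ideal_gen s : I s -> exists c : 'I_n -> A, s = \sum_l c l * xi l.
Proof.
have [p ->] := pres.1 s; rewrite /I ev_mpeval => p0.
have [_ [r ->] ->] := taylor p; rewrite p0 rmorph0 add0r.
exists (fun i => phi (pval (mderiv i p)) + \sum_j r i j * xi j).
rewrite -big_split; apply: eq_bigr => i _ /=; rewrite mulrDl big_distrl.
by congr (_ + _); apply: eq_bigr => j _ /=; ring.
Qed.

(** Subtracting a constant combination of the relations kills the differential without changing the
    value in [A]; only the second-order Taylor remainder is left. *)
Lemma cotangent p : pval p = 0 -> (differential p <= jacobian)%MS ->
  ideal_sq I (mpeval phi x p).
Proof.
move=> p0 /submxP[D DE]; pose p' := p - \sum_i mpolyC n (D ord0 i) * f i.
have -> : mpeval phi x p = mpeval phi x p'.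
  rewrite rmorphB rmorph_sum big1 ?subr0 // => i _.
  by rewrite rmorphM /= relation0 mulr0.
have dp' : differential p' = 0.
  rewrite differentialB differential_sum DE mulmx_sum_row; apply/eqP; rewrite subr_eq0; apply/eqP.
  by apply: eq_bigr => i _; rewrite differentialC rowK.
have [r ir ->] := taylor p'.
rewrite (_ : pval p' = 0) ?rmorph0 ?add0r; last first.
  rewrite rmorphB /= p0 rmorph_sum big1 ?subr0 // => i _.
  by rewrite rmorphM /= pval_relation mulr0.
rewrite big1 ?add0r => [|i _]; first exact: ideal_sq_ideal2 ir.
by have /rowP/(_ i) := dp'; rewrite !mxE => ->; rewrite rmorph0 mul0r.
Qed.

(** A row outside the row space is detected by a column of the cokernel matrix, which is a tangent
    vector. *)
Lemma tangent_separates p : ~~ (differential p <= jacobian)%MS ->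
  exists2 w : 'cV[k]_n, jacobian *m w = 0 & differential p *m w != 0.
Proof.
rewrite submxE => /matrix0Pn[i [j]]; rewrite ord1 => nz {i}.
exists (col j (cokermx jacobian)); first by rewrite colE mulmxA mulmx_coker mul0mx.
by rewrite [col _ _]colE mulmxA -colE; apply/matrix0Pn; exists ord0, ord0; rewrite mxE.
Qed.

Section Arc.
Variables w z : 'cV[k]_n.
Let T : {poly k} := 'X.

(* The arc a + eps w + eps^2 z, with eps = 'X. *)
Let arc : n.-tuple {poly k} :=
  [tuple (tnth a i)%:P + (w i ord0)%:P * T + (z i ord0)%:P * T ^+ 2 | i < n].
Definition along : {rmorphism mpoly n k -> {poly k}} := mpeval (@polyC k) arc.

Lemma along01 p : (along p)`_0 = pval p /\ (along p)`_1 = (differential p *m w) ord0 ord0.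
Proof.
pose y := [tuple (tnth a i)%:P | i < n].
have E q : mpeval (@polyC k) y q = (pval q)%:P.
  by apply/esym/mpeval_rmorph => // i; rewrite tnth_mktuple.
pose g i := (w i ord0)%:P + (z i ord0)%:P * T.
have [r ir rE] := mpeval_taylor (@polyC k) arc y p.
have hE : (fun i => tnth arc i - tnth y i) = (fun i => g i * T).
  by apply/funext => i; rewrite !tnth_mktuple /g; ring.
have [r' r'E] : exists r', r = r' * T ^+ 2.
  move: ir; rewrite hE => -[c ->]; exists (\sum_i \sum_j c i j * g i * g j).
  rewrite big_distrl; apply: eq_bigr => i _ /=; rewrite big_distrl; apply: eq_bigr => j _ /=.
  by ring.
have -> : along p = (pval p)%:P + (\sum_i (pval (mderiv i p))%:P * g i) * T + r' * T ^+ 2.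
  rewrite [along p](rE : along p = _) E r'E; congr (_ + _ + _); rewrite big_distrl; apply: eq_bigr => i _ /=.
  by rewrite E -mulrA; congr (_ * _); have /(congr1 (@^~ i)) := hE.
rewrite !coefD !coefC /= !coefMX !coefMXn /= !addr0 add0r; split=> //.
rewrite coef_sum mxE; apply: eq_bigr => i _.
by rewrite coefCM /g coefD coefC coefMX /= addr0 mxE.
Qed.

End Arc.

(** The second-order term of an arc enters the second coefficient linearly, so it can be used to
    correct that coefficient. *)
Lemma along_second w z p :
  (along w z p)`_2 = (along w 0 p)`_2 + (differential p *m z) ord0 ord0.
Proof.
have [r [c rE] E] := mpeval_taylor (@polyC k)
  [tuple (tnth a i)%:P + (w i ord0)%:P * 'X + (z i ord0)%:P * 'X ^+ 2 | i < n]
  [tuple (tnth a i)%:P + (w i ord0)%:P * 'X + ((0 : 'cV_n) i ord0)%:P * 'X ^+ 2 | i < n] p.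
have hE i : tnth [tuple (tnth a i)%:P + (w i ord0)%:P * 'X + (z i ord0)%:P * 'X ^+ 2 | i < n] i
  - tnth [tuple (tnth a i)%:P + (w i ord0)%:P * 'X + ((0 : 'cV_n) i ord0)%:P * 'X ^+ 2 | i < n] i
  = (z i ord0)%:P * 'X ^+ 2.
  rewrite !tnth_mktuple mxE polyC0; ring.
rewrite [along w z p](E : along w z p = _) !coefD -addrA; congr (_ + _).
have -> : r`_2 = 0.
  rewrite rE coef_sum big1 // => i _; rewrite coef_sum big1 // => j _; rewrite !hE.
  have -> : c i j * ((z i ord0)%:P * 'X^2) * ((z j ord0)%:P * 'X^2) =
    c i j * (z i ord0)%:P * (z j ord0)%:P * 'X^2 * 'X^2 by ring.
  by rewrite !coefMXn.
rewrite addr0 coef_sum mxE; apply: eq_bigr => i _.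
rewrite hE mulrA coefMXn /= coefMC -/(along w 0 _).
by have [-> _] := along01 w 0 (mderiv i p); rewrite mxE.
Qed.

(* The tangent cone of a smooth variety is a linear space, hence integral: *)
(* otherwise an arc modulo eps^3 along which u and v both have order one   *)
(* would give u v order two.                                              *)
Lemma tangent_cone_domain (G : 'M_(n, m)) u v w s : jacobian *m G = 1%:M ->
  I u -> I v -> I w -> ideal_sq I s -> u * v = w * s -> ideal_sq I u \/ ideal_sq I v.
Proof.
move=> JG Iu Iv Iw Is uv.
have [U uE] := pres.1 u; have [V vE] := pres.1 v; have [W wE] := pres.1 w.
have U0 : pval U = 0 by rewrite -ev_mpeval -uE.
have V0 : pval V = 0 by rewrite -ev_mpeval -vE.
have W0 : pval W = 0 by rewrite -ev_mpeval -wE.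
case: (boolP (differential U <= jacobian)%MS) => [/(cotangent U0)|nU].
  by rewrite -uE; left.
case: (boolP (differential V <= jacobian)%MS) => [/(cotangent V0)|nV].
  by rewrite -vE; right.
exfalso.
have nz1 (M : 'M[k]_1) : (M != 0) = (M ord0 ord0 != 0).
  apply/idP/idP => [/matrix0Pn[i [j]]|M0]; first by rewrite !ord1.
  by apply/matrix0Pn; exists ord0, ord0.
(* Two nonzero linear forms on the tangent space have a common non-zero: one of [t1], [t2],
   [t1 + t2] works. *)
have [t Jt [Ut Vt]] : exists2 t : 'cV[k]_n, jacobian *m t = 0 &
    (differential U *m t) ord0 ord0 != 0 /\ (differential V *m t) ord0 ord0 != 0.
  have [t1 Jt1] := tangent_separates nU; rewrite nz1 => Ut1.
  have [t2 Jt2] := tangent_separates nV; rewrite nz1 => Vt2.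
  have [Vt1|Vt1] := eqVneq ((differential V *m t1) ord0 ord0) 0; last by exists t1.
  have [Ut2|Ut2] := eqVneq ((differential U *m t2) ord0 ord0) 0; last by exists t2.
  exists (t1 + t2); first by rewrite mulmxDr Jt1 Jt2 addr0.
  by rewrite !mulmxDr ![fun_of_matrix (_ + _) _ _]mxE Ut2 addr0 Vt1 add0r.
(* The right inverse [G] of the Jacobian solves for the acceleration that cancels the second-order
   terms of all relations, so the arc satisfies them modulo ['X^3]. *)
pose z := - (G *m \col_i (along t 0 (f i))`_2).
have cube q : (along t z (f q))`_0 = 0 /\ (along t z (f q))`_1 = 0 /\ (along t z (f q))`_2 = 0.
  have [-> ->] := along01 t z (f q); rewrite pval_relation; split=> //.
  have JE (y : 'cV_n) : (differential (f q) *m y) ord0 ord0 = (jacobian *m y) q ord0.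
    by rewrite !mxE; apply: eq_bigr => i _; rewrite !mxE.
  split; first by rewrite JE Jt mxE.
  by rewrite along_second JE /z mulmxN mulmxA JG mul1mx !mxE subrr.
have [S sE [S0 S1]] : exists2 S, s = mpeval phi x S &
    (along t z S)`_0 = 0 /\ (along t z S)`_1 = 0.
  elim: Is => [|u' v' s' Iu' Iv' _ [S -> [S0 S1]]].
    by exists 0; rewrite rmorph0 // !coef0.
  have [U' u'E] := pres.1 u'; have [V' v'E] := pres.1 v'.
  exists (U' * V' + S); first by rewrite rmorphD rmorphM /= -u'E -v'E.
  rewrite rmorphD rmorphM /= !coefD S0 S1 !addr0.
  rewrite !coefM !big_ord_recl !big_ord0 /= ?subn0 /bump /= ?addn0 ?subnn.
  have [-> _] := along01 t z U'; have [-> _] := along01 t z V'.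
  by rewrite -!ev_mpeval -u'E -v'E Iu' Iv' !mul0r mulr0 !addr0.
(* Along the arc [U V] has second coefficient the product of two nonzero slopes, while [W S] and the
   relations contribute zero. *)
have /(pres.2 _).1[q qE] : mpeval phi x (U * V - W * S) = 0.
  by rewrite rmorphB !rmorphM /= -uE -vE -wE -sE uv subrr.
have := congr1 (fun p => (along t z p)`_2) qE.
rewrite rmorphB !rmorphM rmorph_sum coefB coef_sum big1 => [|i _]; last first.
  rewrite rmorphM /= coefM !big_ord_recl big_ord0 /= ?subn0 /bump /= ?addn0.
  by have [-> [-> ->]] := cube i; rewrite !mulr0 !addr0.
rewrite !coefM !big_ord_recl !big_ord0 /= ?subn0 /bump /= ?addn0 ?subnn.
have [-> ->] := along01 t z U; have [-> ->] := along01 t z V; have [-> _] := along01 t z W.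
rewrite U0 V0 W0 S0 S1 !mul0r !mulr0 !add0r !addr0 subr0 => /eqP.
by rewrite mulf_eq0 (negPf Ut) (negPf Vt).
Qed.

(** Modulo the Jacobian every coordinate differential is a multiple of that of [p], so each
    generator of the maximal ideal is a multiple of [p] modulo its square; [nakayama] concludes. *)
Lemma parameter_generates (p : mpoly n k) : pval p = 0 ->
    row_full (col_mx (differential p) jacobian) ->
  exists2 delta, ev delta <> 0 & forall s, I s -> exists w, delta * s = w * mpeval phi x p.
Proof.
move=> p0 full; apply: (nakayama (xi := xi)); first exact: ideal_gen.
move=> l; have : ((delta_mx ord0 l : 'rV[k]_n) <= col_mx (differential p) jacobian)%MS by apply: submx_full.
case/submxP => D DE; pose c := lsubmx D ord0 ord0.
exists 1, (phi c), (xi l - phi c * mpeval phi x p); rewrite rmorph1.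
split; [by apply/eqP; rewrite oner_eq0|by rewrite mul1r addrCA subrr addr0|].
pose P := mvar k l - mpolyC n (tnth a l) - mpolyC n c * p.
have -> : xi l - phi c * mpeval phi x p = mpeval phi x P.
  by rewrite !rmorphB rmorphM /= !mpevalC mpevalX.
apply: cotangent.
  by rewrite !rmorphB rmorphM /= p0 mulr0 subr0 /pval mpevalX mpevalC subrr.
have -> : differential P = rsubmx D *m jacobian.
  rewrite !differentialB differentialC.
  have -> : differential (mvar k l) = delta_mx ord0 l.
    by apply/rowP => i; rewrite !mxE mderiv_mvar rmorph_nat eq_sym.
  have -> : differential (mpolyC n (tnth a l)) = 0.
    by apply/rowP => i; rewrite !mxE mderivC rmorph0.
  rewrite subr0 DE -{1}[D]hsubmxK mul_row_col [lsubmx D]mx11_scalar mul_scalar_mx.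
  by rewrite addrAC subrr add0r.
exact: submxMl.
Qed.

End RationalPoint.

(** * Standard smooth algebras *)

Definition ideal_of (A : comPzRingType) m (f : 'I_m -> A) (p : A) : Prop :=
  exists q : 'I_m -> A, p = \sum_i q i * f i.

Section IdealOf.
Variables (A : comPzRingType) (m : nat) (f : 'I_m -> A).

Lemma ideal_ofD p q : ideal_of f p -> ideal_of f q -> ideal_of f (p + q).
Proof.
move=> [u ->] [v ->]; exists (fun i => u i + v i); rewrite -big_split.
by apply: eq_bigr => i _; rewrite mulrDl.
Qed.

Lemma ideal_ofM p q : ideal_of f q -> ideal_of f (p * q).
Proof.
move=> [v ->]; exists (fun i => p * v i); rewrite big_distrr.
by apply: eq_bigr => i _ /=; rewrite mulrA.
Qed.

Lemma ideal_of_gen i : ideal_of f (f i).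
Proof.
exists (fun j => (j == i)%:R).
by rewrite (bigD1 i) //= eqxx mul1r big1 ?addr0 // => j /negPf->; rewrite mul0r.
Qed.

Lemma ideal_of_sum (J : Type) (r : seq J) (F : J -> A) :
  (forall j, ideal_of f (F j)) -> ideal_of f (\sum_(j <- r) F j).
Proof.
move=> IF; apply: big_ind => //; last exact: ideal_ofD.
by exists (fun=> 0); rewrite big1 // => i _; rewrite mul0r.
Qed.

Lemma ideal_ofN p : ideal_of f p -> ideal_of f (- p).
Proof. by rewrite -mulN1r; apply: ideal_ofM. Qed.

End IdealOf.

Lemma ideal_of_rmorph (A B : comPzRingType) (psi : {rmorphism A -> B}) m n
    (f : 'I_m -> A) (g : 'I_n -> B) p :
  (forall i, ideal_of g (psi (f i))) -> ideal_of f p -> ideal_of g (psi p).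
Proof.
move=> fg [q ->]; rewrite rmorph_sum; apply: ideal_of_sum => i.
by rewrite rmorphM; apply: ideal_ofM.
Qed.

Definition ocons (T : Type) m (u : T) (f : 'I_m -> T) (i : 'I_m.+1) : T :=
  if unlift ord0 i is Some j then f j else u.

Lemma ocons0 T m (u : T) (f : 'I_m -> T) : ocons u f ord0 = u.
Proof. by rewrite /ocons unlift_none. Qed.

Lemma oconsS T m (u : T) (f : 'I_m -> T) i : ocons u f (lift ord0 i) = f i.
Proof. by rewrite /ocons liftK. Qed.

Section Jacobian.
Variables (k : fieldType) (A : comPzRingType) (phi : k -> A).
Variables (n m : nat) (x : n.-tuple A) (f : 'I_m -> mpoly n k) (sigma : 'I_m -> 'I_n).

Definition minor : 'M[A]_m := \matrix_(i, j) mpeval phi x (mderiv (sigma j) (f i)).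

End Jacobian.

(** * Presentations with one new variable: localizations and square roots *)

Section Extend.
Variables (k : fieldType) (A B : comPzRingType).
Variables (phi : {rmorphism k -> A}) (psi : {rmorphism A -> B}).
Variables (n N : nat) (x : n.-tuple A) (y : N.-tuple B) (iota : 'I_n -> 'I_N) (v : 'I_N).
Hypothesis yx : forall i, tnth y (iota i) = psi (tnth x i).
Hypothesis vi : forall j, j = v \/ exists i, j = iota i.
Hypothesis iv : forall i, v <> iota i.
Hypothesis inj : injective iota.
Let phi' : {rmorphism k -> B} := psi \o phi.
Let z := tnth y v.

Lemma mpeval_extend p : mpeval phi' y (ren k iota p) = psi (mpeval phi x p).
Proof.
rewrite (@mpeval_ren k n N iota B phi' [tuple psi (tnth x i) | i < n]).
  by apply/esym/mpeval_rmorph => // i; rewrite tnth_mktuple.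
by move=> i; rewrite tnth_mktuple yx.
Qed.

(** The renamed relations do not involve the new variable, so the matrix is block triangular. *)
Lemma minor_extend m (f : 'I_m -> mpoly n k) (sigma : 'I_m -> 'I_n) H sigma' :
    sigma' ord0 = v -> (forall j, sigma' (lift ord0 j) = iota (sigma j)) ->
  \det (minor phi' y (ocons H (ren k iota \o f)) sigma') =
    mpeval phi' y (mderiv v H) * psi (\det (minor phi x f sigma)).
Proof.
move=> s0 sS; rewrite (expand_det_col _ ord0) big_ord_recl big1 ?addr0 => [|i _]; last first.
  by rewrite mxE oconsS /= s0 mderiv_ren_notin ?rmorph0 ?mul0r.
rewrite mxE ocons0 s0 /cofactor addn0 expr0 mul1r -det_map_mx; congr (_ * \det _).
apply/matrixP => i j; rewrite !mxE oconsS sS /=.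
by rewrite mderiv_ren // mpeval_extend.
Qed.

Section Localization.
Variable h : A.
Hypothesis loc : localization_away psi h.
Hypothesis zh : z * psi h = 1.
Variables (h' : mpoly n k) (h'E : h = mpeval phi x h').
Let H : mpoly N k := mvar k v * ren k iota h' - 1.

(** Rabinowitsch: inverting [h] amounts to adjoining [z] with [z h = 1]. *)
Lemma presents_localization m (f : 'I_m -> mpoly n k) :
  presents phi x f -> presents phi' y (ocons H (ren k iota \o f)).
Proof.
move=> pres; split=> [s|p].
  have [_ /(_ s) [g [N' sE]] _] := loc; have [q qE] := pres.1 g.
  exists (ren k iota q * mvar k v ^+ N').
  rewrite rmorphM rmorphXn /= mpeval_extend -qE -sE mpevalX -/z -mulrA -exprMn_comm.
    by rewrite [psi h * z]mulrC zh expr1n mulr1.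
  exact: mulrC.
have Hy : mpeval phi' y H = 0.
  by rewrite rmorphB rmorphM rmorph1 /= mpevalX -/z mpeval_extend -h'E zh subrr.
split; last first.
  move=> [q ->]; rewrite rmorph_sum big1 // => i _; rewrite rmorphM.
  case: (unliftP ord0 i) => [j ->|->]; last by rewrite ocons0 /= Hy mulr0.
  rewrite oconsS /= mpeval_extend (pres.2 _).2 ?rmorph0 ?mulr0 //.
  exact: ideal_of_gen.
have IH : ideal_of (ocons H (ren k iota \o f)) H.
  by have := ideal_of_gen (ocons H (ren k iota \o f)) ord0; rewrite ocons0.
have Iren q : ideal_of f q -> ideal_of (ocons H (ren k iota \o f)) (ren k iota q).
  apply: ideal_of_rmorph => i.
  by have := ideal_of_gen (ocons H (ren k iota \o f)) (lift ord0 i); rewrite oconsS.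
(* A power of [h'] clears the new variable modulo [H]; Horner's scheme gives the induction. *)
have [M [P [s E]]] : exists M P s, ren k iota h' ^+ M * p = ren k iota P + s * H.
  have [q ->] := mpoly_as_poly (k := k) vi p; elim/poly_ind: q => [|q c [M [P [s E]]]].
    by exists 0%N, 0, 0; rewrite !rmorph0 horner0 mulr0 mul0r addr0.
  exists M.+1, (P + h' ^+ M.+1 * c), (ren k iota P + s * (mvar k v * ren k iota h')).
  rewrite rmorphD rmorphM /= map_polyX map_polyC /= hornerMXaddC mulrDr exprSr.
  have -> : ren k iota h' ^+ M * ren k iota h' * ((map_poly (ren k iota) q).[mvar k v] * mvar k v) =
    (ren k iota h' ^+ M * (map_poly (ren k iota) q).[mvar k v]) * (mvar k v * ren k iota h') by ring.
  rewrite E rmorphD !rmorphM rmorphXn /= /H exprSr.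
  by move: (ren k iota P) (ren k iota c) (ren k iota h') (mvar k v) => a b u w; move: (u ^+ M) => uM; ring.
move=> py.
have : psi (mpeval phi x P) = 0.
  have := congr1 (mpeval phi' y) E.
  by rewrite rmorphM /= py mulr0 rmorphD rmorphM /= Hy mulr0 addr0 mpeval_extend.
have [_ _ /(_ (mpeval phi x P)) tor] := loc => /tor[L].
rewrite h'E -rmorphXn -rmorphM => /(pres.2 _).1 /Iren; rewrite rmorphM rmorphXn /= => IP.
(* Since [v h'] is 1 modulo [H], multiplying by its powers changes nothing modulo [H]; the geometric
   sum gives the cofactor. *)
have -> : p = mvar k v ^+ (L + M) * (ren k iota h' ^+ (L + M) * p)
              - (\sum_(i < L + M) (mvar k v * ren k iota h') ^+ i) * p * H.
  have := subrX1 (mvar k v * ren k iota h') (L + M); rewrite -/H exprMn => E'.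
  rewrite [X in _ - X](_ : _ = H * (\sum_(i < L + M) (mvar k v * ren k iota h') ^+ i) * p); last by ring.
  by rewrite -E'; ring.
apply: ideal_ofD; last by apply: ideal_ofN; apply: ideal_ofM.
apply: ideal_ofM; rewrite exprD -mulrA E mulrDr mulrA.
by apply: ideal_ofD => //; apply: ideal_ofM.
Qed.

End Localization.

Section SquareRoot.
Hypothesis gen : forall s, exists P Q, s = psi P + psi Q * z.
Hypothesis free : forall P Q, psi P + psi Q * z = 0 -> P = 0 /\ Q = 0.
Variables (G : mpoly n k) (zG : z ^+ 2 = psi (mpeval phi x G)).
Let H : mpoly N k := mvar k v ^+ 2 - ren k iota G.

(** Division by the monic [H] leaves a remainder [P + Q z], and freeness returns [P] and [Q] to the
    ideal of relations of [A]. The family [f'] is left open so that [H] can either be added to the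
    relations or be merged with one of them. *)
Lemma presents_sqrt m M (f : 'I_m -> mpoly n k) (f' : 'I_M -> mpoly N k) :
    presents phi x f -> ideal_of f' H -> (forall i, ideal_of f' (ren k iota (f i))) ->
    (forall i, mpeval phi' y (f' i) = 0) ->
  presents phi' y f'.
Proof.
move=> pres IH If f'0; split=> [s|p].
  have [P [Q ->]] := gen s; have [p pE] := pres.1 P; have [q qE] := pres.1 Q.
  exists (ren k iota p + ren k iota q * mvar k v).
  by rewrite rmorphD rmorphM /= !mpeval_extend mpevalX -pE -qE.
split; last first.
  by move=> [q ->]; rewrite rmorph_sum big1 // => i _; rewrite rmorphM /= f'0 mulr0.
have [q ->] := mpoly_as_poly (k := k) vi p.
have mon : 'X^2 - G%:P \is monic by rewrite monicE lead_coefXnsubC.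
rewrite [q](Pdiv.RingMonic.rdivp_eq mon); set q' := Pdiv.Ring.rdivp _ _; set r := Pdiv.Ring.rmodp _ _.
have sr : (size r <= 2)%N.
  by rewrite -ltnS -(size_XnsubC (n := 2) G) // Pdiv.Ring.ltn_rmodpN0 // monic_neq0.
have rE : r = (r`_0)%:P + (r`_1)%:P * 'X.
  apply/polyP => -[|[|i]]; rewrite coefD coefC coefCM coefX /=.
  - by rewrite mulr0 addr0.
  - by rewrite mulr1 add0r.
  - by rewrite mulr0 addr0 nth_default //; apply: leq_trans sr _.
have E : (map_poly (ren k iota) (q' * ('X^2 - G%:P) + r)).[mvar k v] =
    (map_poly (ren k iota) q').[mvar k v] * H + (ren k iota r`_0 + ren k iota r`_1 * mvar k v).
  rewrite {1}rE !rmorphD !rmorphM rmorphB /= !map_polyC map_polyXn map_polyX /=.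
  by rewrite !(hornerD, hornerM, hornerN, hornerXn, hornerC, hornerX).
rewrite E rmorphD rmorphM /=.
have -> : mpeval phi' y H = 0.
  by rewrite rmorphB rmorphXn /= mpevalX -/z zG mpeval_extend subrr.
rewrite mulr0 add0r rmorphD rmorphM /= !mpeval_extend mpevalX -/z => /free[/(pres.2 _).1 I0 /(pres.2 _).1 I1].
apply: ideal_ofD; first exact: ideal_ofM.
apply: ideal_ofD; first exact: ideal_of_rmorph I0.
by rewrite mulrC; apply: ideal_ofM; apply: ideal_of_rmorph I1.
Qed.

End SquareRoot.
End Extend.

Lemma invertibleM (A : comPzRingType) (a b : A) :
  invertible a -> invertible b -> invertible (a * b).
Proof. by move=> [a' aa'] [b' bb']; exists (a' * b'); rewrite mulrACA aa' bb' mulr1. Qed.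

Lemma invertible_rmorph (A B : comPzRingType) (psi : {rmorphism A -> B}) a :
  invertible a -> invertible (psi a).
Proof. by move=> [b ab]; exists (psi b); rewrite -rmorphM ab rmorph1. Qed.

Lemma invertibleMl (A : comPzRingType) (a b : A) : invertible (a * b) -> invertible a.
Proof. by move=> [c abc]; exists (b * c); rewrite mulrA. Qed.

(* The new variable is inserted between the d free and the c dependent ones. *)
Section InsertVariable.
Variables (d c : nat).
Definition insert_var (i : 'I_(d + c)) : 'I_(d + c.+1) :=
  match fintype.split i with inl i => lshift c.+1 i | inr j => rshift d (lift ord0 j) end.

Lemma insert_var_rshift j : insert_var (rshift d j) = rshift d (lift ord0 j).
Proof. by rewrite /insert_var; case: split_ordP => [i /esym/eqP|i /rshift_inj->//]; rewrite eq_lrshift. Qed.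

Lemma insert_var_lshift j : insert_var (lshift c j) = lshift c.+1 j.
Proof. by rewrite /insert_var; case: split_ordP => [i /lshift_inj->//|i /eqP]; rewrite eq_lrshift. Qed.

Lemma insert_var_inj : injective insert_var.
Proof.
move=> i j; case: (split_ordP i) => i' ->; case: (split_ordP j) => j' ->;
  rewrite ?insert_var_lshift ?insert_var_rshift.
- by move/lshift_inj->.
- by move/eqP; rewrite eq_lrshift.
- by move/eqP; rewrite eq_rlshift.
- by move/rshift_inj/lift_inj->.
Qed.

Lemma insert_varP (j : 'I_(d + c.+1)) : j = rshift d ord0 \/ exists i, j = insert_var i.
Proof.
case: (split_ordP j) => i ->; first by right; exists (lshift c i); rewrite insert_var_lshift.
case: (unliftP ord0 i) => [i' ->|->]; last by left.
by right; exists (rshift d i'); rewrite insert_var_rshift.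
Qed.

Lemma insert_var_new i : rshift d ord0 <> insert_var i.
Proof.
case: (split_ordP i) => i' ->; rewrite ?insert_var_lshift ?insert_var_rshift.
  by move/eqP; rewrite eq_rlshift.
by move/rshift_inj/eqP; rewrite (negPf (neq_lift _ _)).
Qed.

Definition insert_tuple (A : Type) (z : A) (x : (d + c).-tuple A) : (d + c.+1).-tuple A :=
  [tuple match fintype.split j with inl i => tnth x (lshift c i)
         | inr i => ocons z (fun i => tnth x (rshift d i)) i end | j < d + c.+1].

Lemma insert_tuple_old A (z : A) x i : tnth (insert_tuple z x) (insert_var i) = tnth x i.
Proof.
rewrite tnth_mktuple; case: (split_ordP i) => i' ->; rewrite ?insert_var_lshift ?insert_var_rshift.
  by rewrite (unsplitK (inl _ i')).
by rewrite (unsplitK (inr _ (lift ord0 i'))) oconsS.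
Qed.

Lemma insert_tuple_new A (z : A) x : tnth (insert_tuple z x) (rshift d ord0) = z.
Proof. by rewrite tnth_mktuple (unsplitK (inr _ ord0)) ocons0. Qed.

End InsertVariable.

(** * Smoothness of localizations and of square-root extensions *)

Section SmoothConstructions.
Variables (k : fieldType) (A B : comPzRingType).
Variables (phi : {rmorphism k -> A}) (psi : {rmorphism A -> B}).

(** The new equation [z h - 1] has derivative [h] in [z], a unit after localization. *)
Lemma standard_smooth_localization d h :
  localization_away psi h -> standard_smooth phi d -> standard_smooth (psi \o phi) d.
Proof.
move=> loc [c [x [f [gen ker inv]]]]; have [[z hz] _ _] := loc.
have [h' h'E] := gen h.
pose y := insert_tuple z [tuple psi (tnth x i) | i < d + c].
have yx i : tnth y (insert_var i) = psi (tnth x i).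
  by rewrite insert_tuple_old tnth_mktuple.
have yv : tnth y (rshift d ord0) = z by rewrite insert_tuple_new.
have zh : tnth y (rshift d ord0) * psi h = 1 by rewrite yv mulrC.
have [gen' ker'] := presents_localization yx (@insert_varP d c) loc zh h'E (conj gen ker).
exists c.+1, y, (ocons (mvar k (rshift d ord0) * ren k (@insert_var d c) h' - 1)
  (ren k (@insert_var d c) \o f)); split=> //.
rewrite -/(minor _ y _ (@rshift d c.+1)).
rewrite (minor_extend phi yx (@insert_var_new d c) (@insert_var_inj d c) f (sigma := @rshift d c)) //; last first.
  by move=> j; rewrite insert_var_rshift.
apply: invertibleM; last exact: invertible_rmorph.
rewrite linearB /= mderivM mderiv_mvar eqxx mul1r mderiv_ren_notin; last exact: insert_var_new.
rewrite mulr0 addr0 -mpolyC1 mderivC subr0 (mpeval_extend phi yx) -h'E.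
by exists z.
Qed.

(* g is the image of a relation F e which, deleted from F, leaves a           *)
(* presentation of A; the differential of g generates the 1-forms of A        *)
(* wherever Delta is invertible.                                              *)
Definition parameter (C : comPzRingType) (chi : k -> C) (g Delta : C) : Prop :=
  exists m (x : m.+1.-tuple C) (F : 'I_m.+1 -> mpoly m.+1 k) (e : 'I_m.+1),
  [/\ presents chi x (F \o lift e), mpeval chi x (F e) = g &
      \det (minor chi x F id) = Delta].

Lemma parameter_localization g Delta h : localization_away psi h ->
  parameter phi g Delta -> parameter (psi \o phi) (psi g) (psi (h * Delta)).
Proof.
move=> loc [m [x [F [e [[gen ker] Fe D]]]]]; have [[z hz] _ _] := loc.
have [h' h'E] := gen h.
pose iota := lift (ord0 : 'I_m.+2).
pose y : m.+2.-tuple B := [tuple ocons z (fun i => psi (tnth x i)) i | i < m.+2].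
have yx i : tnth y (iota i) = psi (tnth x i) by rewrite tnth_mktuple oconsS.
have yv : tnth y ord0 = z by rewrite tnth_mktuple ocons0.
have zh : tnth y ord0 * psi h = 1 by rewrite yv mulrC.
have vi (j : 'I_m.+2) : j = ord0 \/ exists i, j = iota i.
  by case: (unliftP ord0 j) => [i ->|->]; [right; exists i|left].
have iv i : ord0 <> iota i by apply/eqP; rewrite neq_lift.
have inj : injective iota by apply: lift_inj.
have pres' := presents_localization yx vi loc zh h'E (conj gen ker).
pose H := mvar k ord0 * ren k iota h' - 1.
exists m.+1, y, (ocons H (ren k iota \o F)), (lift ord0 e); split.
- have <- // : @ocons (mpoly m.+2 k) m H (ren k iota \o (F \o lift e)) =
    @ocons (mpoly m.+2 k) m.+1 H (ren k iota \o F) \o lift (lift ord0 e).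
  apply/funext => i /=; case: (unliftP ord0 i) => [j ->|->].
    rewrite oconsS /= (_ : lift (lift ord0 e) _ = lift ord0 (lift e j)) ?oconsS //.
    by apply/val_inj; rewrite /= /bump !add1n ltnS addnS.
  by rewrite ocons0 (_ : lift (lift ord0 e) _ = ord0) ?ocons0 //; apply/val_inj.
- by rewrite oconsS /= (mpeval_extend phi yx) Fe.
- rewrite (minor_extend phi yx iv inj F (sigma := id)) // D rmorphM; congr (_ * _).
  rewrite linearB /= mderivM mderiv_mvar eqxx mul1r mderiv_ren_notin; last exact: iv.
  by rewrite mulr0 addr0 -mpolyC1 mderivC subr0 (mpeval_extend phi yx) -h'E.
Qed.

Section Sqrt.
Variables (g : A) (z : B).
Hypothesis gen : forall s, exists P Q, s = psi P + psi Q * z.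
Hypothesis free : forall P Q, psi P + psi Q * z = 0 -> P = 0 /\ Q = 0.
Hypothesis zg : z ^+ 2 = psi g.

(** The derivative [2 z] of the new equation is a unit because [2 z * z = 2 g] is one. *)
Lemma standard_smooth_sqrt_unit d : (2%:R : k) != 0 -> invertible g ->
  standard_smooth phi d -> standard_smooth (psi \o phi) d.
Proof.
move=> two ginv [c [x [f [gen' ker inv]]]]; have [G gE] := gen' g.
pose y := insert_tuple z [tuple psi (tnth x i) | i < d + c].
have yx i : tnth y (insert_var i) = psi (tnth x i).
  by rewrite insert_tuple_old tnth_mktuple.
have yv : tnth y (rshift d ord0) = z by rewrite insert_tuple_new.
have gen1 : forall s, exists P Q, s = psi P + psi Q * tnth y (rshift d ord0) by rewrite yv.
have free1 : forall P Q, psi P + psi Q * tnth y (rshift d ord0) = 0 -> P = 0 /\ Q = 0 by rewrite yv.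
pose H := mvar k (rshift d ord0) ^+ 2 - ren k (@insert_var d c) G.
pose f' := ocons H (ren k (@insert_var d c) \o f).
have zG : tnth y (rshift d ord0) ^+ 2 = psi (mpeval phi x G) by rewrite yv zg gE.
have [|i|i|gen2 ker2] := presents_sqrt (f' := f') yx (@insert_varP d c) gen1 free1 zG (conj gen' ker).
- by have := ideal_of_gen f' ord0; rewrite /f' ocons0.
- by have := ideal_of_gen f' (lift ord0 i); rewrite /f' oconsS.
- rewrite /f'; case: (unliftP ord0 i) => [j ->|->].
    by rewrite oconsS /= (mpeval_extend phi yx) (relation0 (conj gen' ker)) rmorph0.
  by rewrite ocons0 rmorphB rmorphXn /= mpevalX zG (mpeval_extend phi yx) subrr.
exists c.+1, y, f'; split=> //.
rewrite -/(minor _ y _ (@rshift d c.+1)).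
rewrite (minor_extend phi yx (@insert_var_new d c) (@insert_var_inj d c) f (sigma := @rshift d c)) //; last first.
  by move=> j; rewrite insert_var_rshift.
apply: invertibleM; last exact: invertible_rmorph.
rewrite linearB /= expr2 mderivM mderiv_mvar eqxx mul1r mulr1 mderiv_ren_notin; last exact: insert_var_new.
rewrite subr0 rmorphD /= mpevalX yv; apply: (@invertibleMl _ _ z).
have -> : (z + z) * z = psi (phi 2%:R) * psi g.
  by rewrite rmorph_nat rmorph_nat -zg; ring.
apply: invertibleM; last exact: invertible_rmorph.
by do 2!apply: invertible_rmorph; exists 2%:R^-1; rewrite divff.
Qed.

(** The relation [F e] is replaced by [F e - z^2]. With [z] as the free coordinate, the remaining
    minor is that of [F] in the old variables, namely [Delta]. *)
Lemma standard_smooth_sqrt_parameter Delta : invertible Delta -> parameter phi g Delta ->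
  standard_smooth (psi \o phi) 1.
Proof.
move=> inv [m [x [F [e [pres Fe D]]]]].
pose iota := lift (ord0 : 'I_m.+2).
pose y : m.+2.-tuple B := [tuple ocons z (fun i => psi (tnth x i)) i | i < m.+2].
have yx i : tnth y (iota i) = psi (tnth x i) by rewrite tnth_mktuple oconsS.
have yv : tnth y ord0 = z by rewrite tnth_mktuple ocons0.
have vi (j : 'I_m.+2) : j = ord0 \/ exists i, j = iota i.
  by case: (unliftP ord0 j) => [i ->|->]; [right; exists i|left].
have iv i : ord0 <> iota i by apply/eqP; rewrite neq_lift.
have inj : injective iota by apply: lift_inj.
have gen1 : forall s, exists P Q, s = psi P + psi Q * tnth y ord0 by rewrite yv.
have free1 : forall P Q, psi P + psi Q * tnth y ord0 = 0 -> P = 0 /\ Q = 0 by rewrite yv.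
pose f' i := ren k iota (F i) - mvar k ord0 ^+ 2 *+ (i == e).
have zG : tnth y ord0 ^+ 2 = psi (mpeval phi x (F e)) by rewrite yv zg Fe.
have [|i|i|gen2 ker2] := presents_sqrt (f' := f') yx vi gen1 free1 zG pres.
- rewrite -opprB; apply: ideal_ofN.
  by have := ideal_of_gen f' e; rewrite /f' eqxx mulr1n.
- have := ideal_of_gen f' (lift e i); rewrite /f' eq_sym (negPf (neq_lift _ _)) mulr0n subr0.
  by [].
- rewrite /f' rmorphB rmorphMn rmorphXn /= mpevalX (mpeval_extend phi yx).
  case: (unliftP e i) => [j ->|->]; last by rewrite eqxx zG subrr.
  by rewrite eq_sym (negPf (neq_lift _ _)) subr0 [mpeval _ _ _](relation0 pres) rmorph0.
exists m.+1, y, f'; split=> //.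
rewrite (_ : \matrix_(i, j) _ = map_mx psi (minor phi x F id)) ?det_map_mx ?D.
  exact: invertible_rmorph.
apply/matrixP => i j; rewrite !mxE.
have -> : rshift 1 j = iota j by apply/val_inj.
rewrite linearB /= mderiv_ren // rmorphB /= (mpeval_extend phi yx).
rewrite (_ : mderiv _ (_ *+ _) = 0) ?rmorph0 ?subr0 //.
rewrite mderivMn expr2 mderivM mderiv_mvar (negPf (_ : ord0 != iota j)) ?neq_lift //.
by rewrite mul0r mulr0 addr0 mul0rn.
Qed.

End Sqrt.
End SmoothConstructions.

(** * Local parameters at rational points *)

Section ParameterAtPoint.
Variables (k : fieldType) (A : comPzRingType) (phi : {rmorphism k -> A}).
Variable ev : {rmorphism A -> k}.
Hypothesis evphi : forall a, ev (phi a) = a.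
Let I (s : A) := ev s = 0.

Lemma parameter_principal g Delta : parameter phi g Delta -> ev g = 0 -> ev Delta <> 0 ->
  exists2 delta, ev delta <> 0 & forall s, I s -> exists w, delta * s = w * g.
Proof.
move=> [m [x [F [e [pres <- <-]]]]] g0 D0.
apply: (parameter_generates pres evphi).
  by rewrite -(ev_mpeval x evphi).
pose M := \matrix_i differential x ev (F i).
have uM : M \in unitmx.
  rewrite unitmxE unitfE; apply/eqP; rewrite (_ : \det M = ev (\det (minor phi x F id))) //.
  rewrite -det_map_mx; congr (\det _); apply/matrixP => i j; rewrite !mxE.
  by rewrite (ev_mpeval x evphi).
rewrite -sub1mx; have : (1%:M <= M)%MS by rewrite sub1mx row_full_unit.
move=> /submx_trans; apply; apply/row_subP => i; rewrite rowK.
case: (unliftP e i) => [j ->|->]; last first.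
  by rewrite -addsmxE addsmxSl.
have -> : differential x ev (F (lift e j)) = row j (jacobian x (F \o lift e) ev) by rewrite rowK.
by rewrite -addsmxE (submx_trans (row_sub _ _)) // addsmxSr.
Qed.

Section Smooth.
Variables (d c : nat) (x : (d + c).-tuple A) (f : 'I_c -> mpoly (d + c) k).
Hypothesis pres : presents phi x f.
Hypothesis inv : invertible (\det (minor phi x f (@rshift d c))).

Lemma ev_invertible s : invertible s -> ev s != 0.
Proof.
move=> [t st]; apply/eqP => s0; have := congr1 ev st.
by rewrite rmorphM s0 mul0r rmorph1 => /eqP; rewrite eq_sym oner_eq0.
Qed.

Lemma jacobian_minor_unit : rsubmx (jacobian x f ev) \in unitmx.
Proof.
rewrite unitmxE unitfE (_ : \det _ = ev (\det (minor phi x f (@rshift d c)))); first exact: ev_invertible.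
rewrite -det_map_mx; congr (\det _); apply/matrixP => i j; rewrite !mxE.
by rewrite (ev_mpeval x evphi).
Qed.

Lemma jacobian_right_inverse : exists G, jacobian x f ev *m G = 1%:M.
Proof.
exists (col_mx 0 (invmx (rsubmx (jacobian x f ev)))).
rewrite -{1}[jacobian x f ev]hsubmxK mul_row_col mulmx0 add0r.
by rewrite mulmxV // jacobian_minor_unit.
Qed.

End Smooth.

Lemma smooth_tangent_cone_domain d u v w s : standard_smooth phi d ->
  I u -> I v -> I w -> ideal_sq I s -> u * v = w * s -> ideal_sq I u \/ ideal_sq I v.
Proof.
move=> [c [x [f [gen ker inv]]]].
have [G JG] := jacobian_right_inverse inv.
exact: (tangent_cone_domain (conj gen ker) evphi JG).
Qed.

Section Curve.
Variables (c : nat) (x : (1 + c).-tuple A) (f : 'I_c -> mpoly (1 + c) k).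
Hypothesis pres : presents phi x f.
Hypothesis inv : invertible (\det (minor phi x f (@rshift 1 c))).

(** The rows of the Jacobian are independent because it has a right inverse; one more row outside
    their span makes an invertible square matrix, whose determinant is the value of [Delta]. *)
Lemma curve_parameter_aux (G : mpoly (1 + c) k) :
    ~~ (differential x ev G <= jacobian x f ev)%MS ->
  exists2 Delta, ev Delta <> 0 & parameter phi (mpeval phi x G) Delta.
Proof.
move=> nG; exists (\det (minor phi x (ocons G f) (@id 'I_(1 + c)))); last first.
  exists c, x, (ocons G f), ord0; split=> //; last by rewrite ocons0.
  by have -> : ocons G f \o lift ord0 = f by apply/funext => i /=; rewrite oconsS.
rewrite -det_map_mx => /eqP/det0P[v v0 vM]; case/negP: nG.
have E j : v ord0 ord0 * differential x ev G ord0 j +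
    \sum_i v ord0 (lift ord0 i) * jacobian x f ev i j = 0.
  have := congr1 (fun Z : 'rV[k]_(1 + c) => Z ord0 j) vM; rewrite !mxE big_ord_recl => Ej; rewrite -[RHS]Ej.
  congr (_ + _); first by rewrite !mxE ocons0 (ev_mpeval x evphi).
  by apply: eq_bigr => i _; rewrite !mxE oconsS (ev_mpeval x evphi).
pose v' := \row_i v ord0 (lift ord0 i).
have E' : v ord0 ord0 *: differential x ev G + v' *m jacobian x f ev = 0.
  by apply/rowP => j; rewrite !mxE -[RHS](E j) mxE; congr (_ + _); apply: eq_bigr => i _; rewrite !mxE.
have [v00|v00] := eqVneq (v ord0 ord0) 0.
  have [R JR] := jacobian_right_inverse inv; case/eqP: v0.
  have : v' = 0.
    by rewrite -[v']mulmx1 -JR mulmxA -[v' *m _]add0r -{1}(scale0r (differential x ev G)) -v00 E' mul0mx.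
  move=> v'0; apply/rowP => i; rewrite mxE; case: (unliftP ord0 i) => [j ->|->//].
  by have := congr1 (fun Z : 'rV[k]_c => Z ord0 j) v'0; rewrite !mxE.
rewrite -[differential _ _ _]scale1r -(mulVf v00) -scalerA scalemx_sub //.
rewrite (_ : _ *: _ = - (v' *m jacobian x f ev)); last by apply/eqP; rewrite -addr_eq0 E'.
by rewrite -mulNmx submxMl.
Qed.

End Curve.

Lemma curve_parameter g : standard_smooth phi 1 -> I g -> ~ ideal_sq I g ->
  exists2 Delta, ev Delta <> 0 & parameter phi g Delta.
Proof.
move=> [c [x [f [gen ker inv]]]] g0 ng; have [G gE] := gen g.
rewrite gE; apply: curve_parameter_aux => //.
apply/negP => /(cotangent (conj gen ker) evphi) sq; apply: ng; rewrite gE; apply: sq.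
by rewrite -(ev_mpeval x evphi) -gE.
Qed.

(** The free coordinate, translated to vanish at the point, serves: a combination of relations whose
    differential is zero in the dependent variables is trivial, by the invertible minor. *)
Lemma curve_has_parameter : standard_smooth phi 1 ->
  exists t Delta, [/\ ev t = 0, ev Delta <> 0 & parameter phi t Delta].
Proof.
move=> [c [x [f [gen ker inv]]]].
pose G : mpoly (1 + c) k := mvar k ord0 - mpolyC _ (ev (tnth x ord0)).
exists (mpeval phi x G).
have [|D D0 pD] := @curve_parameter_aux c x f (conj gen ker) inv G; last first.
  by exists D; rewrite (ev_mpeval x evphi) rmorphB /= /pval !(mpevalX, mpevalC) tnth_mktuple subrr.
apply/negP => /submxP[v vE].
have dG j : differential x ev G ord0 j = (ord0 == j)%:R.
  by rewrite mxE linearB /= mderivC subr0 mderiv_mvar rmorph_nat.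
have v0 : v = 0.
  have : v *m rsubmx (jacobian x f ev) = 0.
    apply/rowP => j; have := dG (rshift 1 j); rewrite vE !mxE /= => Ej; rewrite -[RHS]Ej.
    by apply: eq_bigr => i _; rewrite !mxE.
  move/(congr1 (fun Z => Z *m invmx (rsubmx (jacobian x f ev)))).
  by rewrite mulmxK ?mul0mx // (jacobian_minor_unit inv).
have := dG ord0; rewrite vE v0 mul0mx mxE eqxx => /eqP.
by rewrite eq_sym oner_eq0.
Qed.

End ParameterAtPoint.

(** * The algebra of the modification *)

Definition integral_ring (A : comPzRingType) : Prop :=
  (1 : A) <> 0 /\ forall s t : A, s * t = 0 -> s = 0 \/ t = 0.

(* The ring of the modification over an affine open with ring A: generated by *)
(* x and y, torsion-free, and with trivial intersection of A and A x + A y.   *)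
Record spectral_algebra (A B : comPzRingType) (psi : {rmorphism A -> B}) (x y : B)
    (b1 b2 b3 : A) : Prop := SpectralAlgebra {
  sa_gen : forall s, exists a b c, s = psi a + psi b * x + psi c * y;
  sa_xx : x ^+ 2 = psi b1;
  sa_yy : y ^+ 2 = psi b2;
  sa_xy : x * y = psi b3;
  sa_const : forall a b c, psi a + psi b * x + psi c * y = 0 -> a = 0;
  sa_torsion_free : forall a s, a <> 0 -> psi a * s = 0 -> s = 0 }.

Lemma spectral_algebra_sym (A B : comPzRingType) (psi : {rmorphism A -> B}) x y b1 b2 b3 :
  spectral_algebra psi x y b1 b2 b3 -> spectral_algebra psi y x b2 b1 b3.
Proof.
case=> gen xx yy xy const tf; split=> // [s||a b c].
- by have [a [b [c ->]]] := gen s; exists a, c, b; rewrite addrAC.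
- by rewrite mulrC.
- by rewrite addrAC => /const.
Qed.

Section SpectralAlgebra.
Variables (k : closedFieldType) (A B : comPzRingType).
Variables (phi : {rmorphism k -> A}) (psi : {rmorphism A -> B}).
Variables (x y : B) (b1 b2 b3 : A).
Hypothesis sa : spectral_algebra psi x y b1 b2 b3.
Hypothesis dom : integral_ring A.

Lemma sa_inj a : psi a = 0 -> a = 0.
Proof. by move=> a0; apply: (sa_const sa (b := 0) (c := 0)); rewrite a0 rmorph0 !mul0r !addr0. Qed.

(** As [b1 (y - c x) = x (x y - c x^2) = 0], torsion-freeness gives [y = c x]. Then 1 and [x] form a
    basis over [A]: the constant term vanishes by [sa_const], and [Q x = 0] gives [Q b1 = 0]. *)
Lemma standard_smooth_spectral (two : (2%:R : k) != 0) c :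
    b1 <> 0 -> b3 = c * b1 -> standard_smooth phi 1 ->
    invertible b1 \/ (exists2 Delta, invertible Delta & parameter phi b1 Delta) ->
  standard_smooth (psi \o phi) 1.
Proof.
move=> b10 b3E sm; have yE : y = psi c * x.
  apply/eqP; rewrite -subr_eq0; apply/eqP; apply: (sa_torsion_free sa b10).
  rewrite -(sa_xx sa).
  have -> : x ^+ 2 * (y - psi c * x) = x * (x * y - psi c * x ^+ 2) by ring.
  by rewrite (sa_xy sa) (sa_xx sa) b3E rmorphM subrr mulr0.
have gen s : exists P Q, s = psi P + psi Q * x.
  have [a [b [d ->]]] := sa_gen sa s; exists a, (b + d * c).
  by rewrite yE rmorphD rmorphM; ring.
have free P Q : psi P + psi Q * x = 0 -> P = 0 /\ Q = 0.
  move=> E; have P0 : P = 0.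
    by apply: (sa_const sa (b := Q) (c := 0)); rewrite E rmorph0 mul0r addr0.
  split=> //; have : psi (Q * b1) = 0.
    by move: E; rewrite P0 rmorph0 add0r rmorphM -(sa_xx sa) expr2 mulrA => ->; rewrite mul0r.
  by move=> /sa_inj /dom.2[].
case=> [inv|[Delta inv par]].
  exact: (standard_smooth_sqrt_unit gen free (sa_xx sa) two inv sm).
exact: (standard_smooth_sqrt_parameter gen free (sa_xx sa) inv par).
Qed.

Section Point.
Variable ev : {rmorphism A -> k}.
Hypotheses (ev1 : ev b1 = 0) (ev2 : ev b2 = 0) (ev3 : ev b3 = 0).

(** The point [x = y = 0] over a common zero of the [b_i]: taking the constant term is well defined
    by [sa_const], and multiplicative there because products of fibre coordinates evaluate to
    zero. *)
Lemma spectral_point : exists evB : {rmorphism B -> k},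
  forall a b c, evB (psi a + psi b * x + psi c * y) = ev a.
Proof.
have /choice[f fP] : forall s, exists r a b c,
    s = psi a + psi b * x + psi c * y /\ r = ev a.
  move=> s; have [a [b [c E]]] := sa_gen sa s; by exists (ev a), a, b, c.
have fE a b c : f (psi a + psi b * x + psi c * y) = ev a.
  have [a' [b' [c' [E ->]]]] := fP (psi a + psi b * x + psi c * y).
  have : psi (a - a') + psi (b - b') * x + psi (c - c') * y = 0.
    by rewrite !rmorphB -(subrr (psi a + psi b * x + psi c * y)) {2}E; ring.
  by move=> /(sa_const sa) /eqP; rewrite subr_eq0 => /eqP->.
have [u v|u v||g gE] := @rmorphism_of_morph B k f.
- have [a [b [c [-> ->]]]] := fP u; have [a' [b' [c' [-> ->]]]] := fP v.
  rewrite -rmorphB -(fE _ (b - b') (c - c')) !rmorphB.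
  by congr f; ring.
- have [a [b [c [-> ->]]]] := fP u; have [a' [b' [c' [-> ->]]]] := fP v.
  pose d := a * a' + (b * b' * b1 + c * c' * b2 + (b * c' + c * b') * b3).
  have -> : ev a * ev a' = ev d.
    by rewrite /d !rmorphD !rmorphM ev1 ev2 ev3 !mulr0 !addr0.
  rewrite -(fE d (a * b' + b * a') (a * c' + c * a')); congr f.
  rewrite /d !rmorphD !rmorphM -(sa_xx sa) -(sa_yy sa) -(sa_xy sa).
  by rewrite !rmorphD !rmorphM; ring.
- by rewrite -(rmorph1 ev) -(fE 1 0 0) !rmorph0 rmorph1 !mul0r !addr0.
by exists g => a b c; rewrite gE.
Qed.

End Point.

Section MultipleZero.
Variable ev : {rmorphism A -> k}.
Hypothesis evphi : forall a, ev (phi a) = a.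
Variables (t b1' b2' b3' : A).
Hypothesis t0 : ev t = 0.
Hypothesis t_gen : forall s, ev s = 0 -> exists w, s = w * t.
Hypotheses (b1E : b1 = t ^+ 2 * b1') (b2E : b2 = t ^+ 2 * b2') (b3E : b3 = t ^+ 2 * b3').
Hypothesis bn0 : ~ (b1 = 0 /\ b2 = 0).
Variable evB : {rmorphism B -> k}.
Hypothesis evBE : forall a b c, evB (psi a + psi b * x + psi c * y) = ev a.
Let J (s : B) := evB s = 0.

Let evB_psi a : evB (psi a) = ev a.
Proof. by rewrite -(evBE a 0 0) !rmorph0 !mul0r !addr0. Qed.
Let evBx : evB x = 0.
Proof. by rewrite -(rmorph0 ev) -(evBE 0 1 0) !rmorph0 rmorph1 mul1r mul0r add0r addr0. Qed.
Let evBy : evB y = 0.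
Proof. by rewrite -(rmorph0 ev) -(evBE 0 0 1) !rmorph0 rmorph1 mul1r mul0r !add0r. Qed.

(* If the local ring at the point x = y = t = 0 has an integral tangent cone, *)
(* then x^2 = b1' t^2 makes x a multiple of t modulo higher order, and        *)
(* likewise y; so t generates the maximal ideal, x and y are locally          *)
(* divisible by t, and then x = y = 0.                                        *)
Lemma multiple_zero_not_smooth :
    (forall u v w s, J u -> J v -> J w -> ideal_sq J s -> u * v = w * s ->
      (exists2 h, evB h <> 0 & ideal_sq J (h * u)) \/
      (exists2 h, evB h <> 0 & ideal_sq J (h * v))) ->
  False.
Proof.
move=> cone.
have Jt : J (psi t) by rewrite /J evB_psi.
(* With [r^2] the value of [c] at the point, [(z - r t)(z + r t) = (c - r^2) t^2] lies in [J] times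
   its square, so the cone hypothesis puts one factor in the square after multiplication by some
   [h]. *)
have root_of (z : B) (c : A) : J z -> z ^+ 2 = psi (t ^+ 2 * c) ->
    exists h w s, [/\ evB h <> 0, h * z = w * psi t + s & ideal_sq J s].
  move=> Jz zz.
  have [|r] := closed_rootP ('X^2 - (ev c)%:P : {poly k}) _; first by rewrite size_XnsubC.
  rewrite /root !hornerE subr_eq0 => /eqP rE.
  have [|||||[h h0 sq]|[h h0 sq]] := cone (z - psi (phi r) * psi t) (z + psi (phi r) * psi t)
     (psi (c - phi r ^+ 2)) (psi t * psi t).
  - by rewrite /J rmorphB rmorphM /= Jz Jt mulr0 subr0.
  - by rewrite /J rmorphD rmorphM /= Jz Jt mulr0 addr0.
  - by rewrite /J evB_psi rmorphB rmorphXn /= evphi rE subrr.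
  - exact: ideal_sqM.
  - have -> : (z - psi (phi r) * psi t) * (z + psi (phi r) * psi t) =
       z ^+ 2 - (psi (phi r)) ^+ 2 * (psi t * psi t) by ring.
    by rewrite zz !(rmorphB, rmorphXn, rmorphM) /=; ring.
  - by exists h, (h * psi (phi r)), (h * (z - psi (phi r) * psi t)); split=> //; ring.
  - by exists h, (- h * psi (phi r)), (h * (z + psi (phi r) * psi t)); split=> //; ring.
have hx := root_of x b1' evBx; rewrite (sa_xx sa) -b1E in hx; have {}hx := hx erefl.
have hy := root_of y b2' evBy; rewrite (sa_yy sa) -b2E in hy; have {}hy := hy erefl.
pose xi : 'I_3 -> B := tnth [tuple psi t; x; y].
have [|l|delta d0 dP] := @nakayama B k evB 3 xi (psi t).
- move=> s; have [a [b [c ->]]] := sa_gen sa s; rewrite evBE => /t_gen[w ->].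
  exists (tnth [tuple psi w; psi b; psi c]).
  by rewrite !big_ord_recl big_ord0 /xi !(tnth_nth 0) /= rmorphM; ring.
- have := ltn_ord l; case: l => -[|[|[|//]]] i _; rewrite /xi (tnth_nth 0) //=.
  exists 1, 1, 0; rewrite rmorph1 addr0; split=> //; last by constructor.
  by apply/eqP; rewrite oner_eq0.
have [wx xE] := dP _ evBx; have [wy yE] := dP _ evBy.
have [a [b [c dE]]] := sa_gen sa delta.
have a0 : ev a != 0 by apply/eqP; rewrite -(evBE a b c) -dE.
(* The norm of [delta] under the sign change of [x] and [y]: it lies in [A] and is nonzero at the
   point, so [delta] can be replaced by an element of [A]. *)
pose N := a ^+ 2 - (b ^+ 2 * b1 + (b * c * b3) *+ 2 + c ^+ 2 * b2).
pose dc := psi a - psi b * x - psi c * y.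
have dN : dc * delta = psi N.
  rewrite dE /N !(rmorphB, rmorphD, rmorphM, rmorphXn, rmorphMn) /=.
  by rewrite -(sa_xx sa) -(sa_yy sa) -(sa_xy sa) /dc; ring.
have evN : ev N = ev a ^+ 2.
  rewrite /N b1E b2E b3E !(rmorphB, rmorphD, rmorphM, rmorphXn, rmorphMn) /= t0.
  by rewrite ?expr0n /= !(mul0r, mulr0, addr0, mul0rn, subr0).
clearbody N.
have [a1 [c11 [c12 E1]]] := sa_gen sa (dc * wx).
have [a2 [c21 [c22 E2]]] := sa_gen sa (dc * wy).
have {}xE : psi (- (t * a1)) + psi (N - t * c11) * x + psi (- (t * c12)) * y = 0.
  have : psi N * x - dc * wx * psi t = 0 by rewrite -dN -!mulrA xE; ring.
  by rewrite E1 => <-; rewrite !(rmorphB, rmorphN, rmorphM) /=; ring.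
have {}yE : psi (- (t * a2)) + psi (- (t * c21)) * x + psi (N - t * c22) * y = 0.
  have : psi N * y - dc * wy * psi t = 0 by rewrite -dN -!mulrA yE; ring.
  by rewrite E2 => <-; rewrite !(rmorphB, rmorphN, rmorphM) /=; ring.
(* Dropping the constant terms leaves a homogeneous linear system in [x], [y], with matrix [N] times
   the identity modulo [t]; its determinant [D] is nonzero. *)
have x1 := sa_const sa xE; have y1 := sa_const sa yE.
rewrite x1 rmorph0 add0r in xE; rewrite y1 rmorph0 add0r in yE.
pose D := (N - t * c11) * (N - t * c22) - (t * c12) * (t * c21).
have D0 : D <> 0.
  move=> /(congr1 ev); rewrite rmorph0 /D !(rmorphB, rmorphM) /= t0 !mul0r !subr0 evN.
  by move/eqP; rewrite mulf_eq0 expf_eq0 /= (negPf a0).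
have x0 : x = 0.
  apply: (sa_torsion_free sa D0).
  transitivity (psi (N - t * c22) * (psi (N - t * c11) * x + psi (- (t * c12)) * y)
    + psi (t * c12) * (psi (- (t * c21)) * x + psi (N - t * c22) * y)).
    by rewrite /D !(rmorphB, rmorphN, rmorphM) /=; ring.
  by rewrite xE yE !mulr0 addr0.
have y0 : y = 0.
  apply: (sa_torsion_free sa D0).
  transitivity (psi (t * c21) * (psi (N - t * c11) * x + psi (- (t * c12)) * y)
    + psi (N - t * c11) * (psi (- (t * c21)) * x + psi (N - t * c22) * y)).
    by rewrite /D !(rmorphB, rmorphN, rmorphM) /=; ring.
  by rewrite xE yE !mulr0 addr0.
by apply: bn0; split; apply: sa_inj; rewrite -?(sa_xx sa) -?(sa_yy sa) ?x0 ?y0 expr0n.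
Qed.

End MultipleZero.
End SpectralAlgebra.

(** * Affine opens and rational points *)

Lemma opens_eq (T : topologicalType) (U W : opens T) :
  open_set U = open_set W -> U = W.
Proof.
case: U W => [U oU] [W oW] /= E; move: oW; rewrite -E => oW.
by rewrite (Prop_irrelevance oU oW).
Qed.

Definition interU (T : topologicalType) (U W : opens T) : opens T :=
  Opens (openI (open_setP U) (open_setP W)).

Lemma localization_extend (k : fieldType) (A B : comPzRingType) (psi : {rmorphism A -> B}) h
    (ev : {rmorphism A -> k}) :
  localization_away psi h -> ev h <> 0 ->
  exists ev' : {rmorphism B -> k}, forall a, ev' (psi a) = ev a.
Proof.
move=> [[z hz] frac tor] /eqP h0.
have /choice[f fP] : forall s, exists r g n, s * psi h ^+ n = psi g /\ r = ev g / ev h ^+ n.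
  by move=> s; have [g [n E]] := frac s; exists (ev g / ev h ^+ n), g, n.
have fE s g n : s * psi h ^+ n = psi g -> f s = ev g / ev h ^+ n.
  move=> E; have [g' [n' [E' ->]]] := fP s.
  have : psi (g * h ^+ n' - g' * h ^+ n) = 0.
    by rewrite rmorphB !rmorphM !rmorphXn -E -E'; ring.
  move=> /tor[N /(congr1 ev)]; rewrite rmorph0 rmorphM rmorphXn => /eqP.
  rewrite mulf_eq0 expf_eq0 (negPf h0) andbF /= rmorphB !rmorphM !rmorphXn subr_eq0 => /eqP H.
  by apply/eqP; rewrite eqr_div ?expf_neq0 // H.
have [u v|u v||g gE] := @rmorphism_of_morph B k f.
- have [a [n [E ->]]] := fP u; have [b [m [E' ->]]] := fP v.
  rewrite (fE _ (a * h ^+ m - b * h ^+ n) (n + m)%N).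
    by rewrite rmorphB !rmorphM !rmorphXn exprD; field; rewrite !expf_neq0.
  by rewrite rmorphB !rmorphM !rmorphXn -E -E' exprD; ring.
- have [a [n [E ->]]] := fP u; have [b [m [E' ->]]] := fP v.
  rewrite (fE _ (a * b) (n + m)%N); first by rewrite rmorphM exprD; field; rewrite !expf_neq0.
  by rewrite rmorphM -E -E' exprD; ring.
- by rewrite (fE _ 1 0%N) ?rmorph1 ?expr0 ?mulr1 ?divr1.
by exists g => a; rewrite gE (fE _ a 0%N) ?expr0 ?mulr1 ?divr1.
Qed.

Section RingedSpace.
Variables (k : fieldType) (X : ringed_space k).
Implicit Types U W : opens X.

Definition scalarR U : {rmorphism k -> sec U} := res (@sub_fullU _ U) \o scalarT X.

Lemma res_scalar U W (h : W `<=` U) a : res h (scalar U a) = scalar W a.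
Proof. exact: res_comp. Qed.

Lemma invertible_at_in U (s : sec U) x : invertible_at s x -> U x.
Proof. by move=> [W [h [Wx _]]]; apply: h. Qed.

Lemma invertible_at_res U W (h : W `<=` U) (s : sec U) x : W x ->
  invertible_at (res h s) x <-> invertible_at s x.
Proof.
move=> Wx; split=> [[Z [hZ [Zx inv]]]|[Z [hZ [Zx inv]]]].
  exists Z, (subset_trans hZ h); split=> //.
  by rewrite -(res_comp h hZ).
have h1 : interU Z W `<=` Z by apply: subIsetl.
have h2 : interU Z W `<=` W by apply: subIsetr.
exists (interU Z W), h2; split=> //.
rewrite (res_comp h h2 (subset_trans h1 hZ)) -(res_comp hZ h1).
exact: invertible_rmorph.
Qed.

Lemma invertible_at1 U x : U x -> invertible_at (1 : sec U) x.
Proof. by move=> Ux; exists U, (@subset_refl _ _); split=> //; exists 1; rewrite rmorph1 mulr1. Qed.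

Lemma invertible_atM U (s t : sec U) x :
  invertible_at (s * t) x <-> invertible_at s x /\ invertible_at t x.
Proof.
split=> [[W [h [Wx]]]|[[W [h [Wx inv]]] [W' [h' [Wx' inv']]]]].
  rewrite rmorphM => inv; split; exists W, h; split=> //; first exact: invertibleMl inv.
  by move: inv; rewrite mulrC; apply: invertibleMl.
have h1 : interU W W' `<=` W by apply: subIsetl.
have h2 : interU W W' `<=` W' by apply: subIsetr.
exists (interU W W'), (subset_trans h1 h); split=> //; rewrite rmorphM; apply: invertibleM.
  by rewrite -(res_comp h h1); apply: invertible_rmorph.
have -> : res (subset_trans h1 h) t = res h2 (res h' t) by rewrite (res_comp h' h2 (subset_trans h1 h)).
exact: invertible_rmorph.
Qed.

Lemma invertible_atX U (s : sec U) n x : invertible_at s x -> invertible_at (s ^+ n) x.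
Proof.
move=> inv; elim: n => [|n IH]; first by rewrite expr0; apply/invertible_at1/(invertible_at_in inv).
by rewrite exprS; apply/invertible_atM.
Qed.

Lemma open_nonvanishing U (s : sec U) : open (nonvanishing s).
Proof.
rewrite openE => x [W [h [Wx inv]]]; rewrite /interior nbhsE; exists W.
  by split=> //; apply: open_setP.
by move=> y Wy; exists W, h.
Qed.

Definition basicU U (s : sec U) : opens X := Opens (open_nonvanishing s).

Lemma basicU_sub U (s : sec U) : basicU s `<=` U.
Proof. by move=> x; apply: invertible_at_in. Qed.

(** Primes of a localization are the primes avoiding [f]; invertibility of a fraction at a point is
    that of its numerator, which transports all four conditions from [U]. *)
Lemma affine_basic U (f : sec U) : affine_open U -> affine_open (basicU f).
Proof.
move=> [prime point basic loc]; set W := basicU f.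
pose h : W `<=` U := @basicU_sub U f.
have locW := loc f W h erefl.
have [[z hz] frac tor] := locW.
have invW s g n x : W x -> s * res h f ^+ n = res h g -> invertible_at s x <-> invertible_at g x.
  move=> Wx E; rewrite -(invertible_at_res h g Wx) -E; split=> [inv|/invertible_atM[]//].
  apply/invertible_atM; split=> //; apply: invertible_atX.
  exact/(invertible_at_res h f Wx).
have primeW x : W x -> prime_ideal (point_ideal (U := W) x).
  move=> Wx; have Ux := h _ Wx; have P := prime x Ux.
  have inv0 : ~ invertible_at (0 : sec W) x.
    move/(invW 0 0 0%N x Wx); rewrite mul0r rmorph0 => /(_ erefl).
    exact: (prime0 P).
  split=> //.
  - move=> s t ns nt; have [g [n E]] := frac s; have [g' [m E']] := frac t.
    rewrite /point_ideal /= (invW _ (g * f ^+ m + g' * f ^+ n) (n + m)%N) //; last first.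
      by rewrite rmorphD !rmorphM !rmorphXn -E -E' exprD; ring.
    by apply: (primeD P); apply: (primeMr P) ; [move=> /(invW _ _ _ _ Wx E).2|move=> /(invW _ _ _ _ Wx E').2].
  - by move=> s t nt /invertible_atM[].
  - by move=> n1; apply: n1; apply: invertible_at1.
  - move=> s t; rewrite /point_ideal /= invertible_atM => nst.
    by have [is_|ns] := pselect (invertible_at s x); [right=> it; apply: nst|left].
split=> //.
- move=> P Pp; have [x [[Ux xE] xuniq]] := point _ (prime_preimage (res h) Pp).
  have Wx : W x.
    apply: contrapT => nWx; have : point_ideal x f by [].
    rewrite xE /= => Pf; apply: (prime1 Pp); rewrite -hz.
    exact: primeMr.
  have memP (Q : set (sec W)) : prime_ideal Q -> ~ Q (res h f) -> forall s g n,
      s * res h f ^+ n = res h g -> Q s <-> Q (res h g).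
    move=> Qp nf s g n <-; split=> [|/(primeM Qp)[//|/(primeX Qp)//]].
    exact: primeMr.
  have nPf : ~ P (res h f) by move=> Pf; apply: (prime1 Pp); rewrite -hz; apply: primeMr.
  exists x; split.
    split=> //; apply/funext => s; apply/propext; have [g [n E]] := frac s.
    rewrite (memP P Pp nPf _ _ _ E) /point_ideal /= (invW _ _ _ _ Wx E).
    by have := congr1 (fun Q : set (sec U) => Q g) xE; rewrite /= /point_ideal /= => ->.
  move=> y [Wy yE]; apply: xuniq; split; first exact: (h _ Wy).
  apply/funext => s; apply/propext; rewrite /= -yE /point_ideal /=.
  by rewrite (invertible_at_res h s Wy).
- move=> Z x ZW Zx; have [g [gx gZ]] := basic Z x (subset_trans ZW h) Zx.
  exists (res h g); split; first by apply/invertible_at_res; first exact: ZW.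
  move=> y gy; apply: gZ; apply/(invertible_at_res h g) => //.
  exact: invertible_at_in gy.
- move=> g Z hZ ZE; have [g0 [n E]] := frac g.
  (* With [g = g0 / f^n], the basic open of [g] inside that of [f] is the basic open of [g0 f] in
     [U]. *)
  have ZE' : open_set Z = nonvanishing (g0 * f).
    rewrite ZE; apply/seteqP; split=> x.
      move=> gx; have Wx := invertible_at_in gx.
      by apply/invertible_atM; split=> //; apply/(invW _ _ _ _ Wx E).
    by move=> /invertible_atM[gx fx]; apply/(invW _ _ _ _ fx E).
  have hZU := subset_trans hZ h.
  have [[w ww] fracZ torZ] := loc _ Z hZU ZE'.
  have rr s : res hZ (res h s) = res hZU s by apply: res_comp.
  have resg : res hZU g0 = res hZ g * res hZ (res h f) ^+ n by rewrite -rr -E rmorphM rmorphXn.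
  split.
  + apply: (@invertibleMl _ _ (res hZ (res h f) ^+ n.+1)); exists w; rewrite -ww rmorphM resg -rr exprSr.
    by ring.
  + move=> s; have [u [m uE]] := fracZ s; exists (res h u * z ^+ (n.+1 * m)), m.
    rewrite rmorphM rr -uE rmorphM resg -rr -mulrA; congr (_ * _).
    rewrite rmorphXn exprM -exprMn; congr (_ ^+ _).
    rewrite -[_ * _ ^+ n * _]mulrA -exprSr -mulrA -exprMn -rmorphM hz rmorph1 expr1n mulr1.
    by [].
  + move=> s s0; have [u [m uE]] := frac s.
    have /torZ[l] : res hZU u = 0 by rewrite -rr -uE rmorphM s0 mul0r.
    move=> /(congr1 (res h)); rewrite rmorph0 rmorphM rmorphXn rmorphM -E -uE => E0.
    exists l; have : (g * res h f ^+ n.+1) ^+ l * (s * res h f ^+ m) * z ^+ (n.+1 * l + m) = 0.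
      by rewrite exprSr [g * (_ * _)]mulrA E0 mul0r.
    rewrite exprMn -exprM => <-.
    rewrite (_ : g ^+ l * _ * _ * _ = g ^+ l * s * (res h f * z) ^+ (n.+1 * l + m)).
      by rewrite hz expr1n mulr1.
    by rewrite exprMn !exprD; ring.
Qed.

Lemma affine_nbhd U W x : affine_open U -> W x -> U x ->
  exists f : sec U, invertible_at f x /\ basicU f `<=` W.
Proof.
move=> [_ _ basic _] Wx Ux.
have [f [fx fW]] := basic (interU W U) x (@subIsetr _ _ _) (conj Wx Ux).
by exists f; split=> // y /fW[].
Qed.

Lemma affine_localization U (f : sec U) : affine_open U ->
  localization_away (res (@basicU_sub U f)) f.
Proof. by move=> [_ _ _ loc]; apply: loc. Qed.

Lemma basic_standard_smooth U (f : sec U) d : affine_open U ->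
  standard_smooth (scalar U) d -> standard_smooth (scalar (basicU f)) d.
Proof.
move=> aff sm; have := @standard_smooth_localization k _ _ (scalarR U) _ d _ (affine_localization f aff) sm.
suff -> : res (@basicU_sub U f) \o scalarR U = scalar (basicU f) :> (k -> _) by [].
by apply/funext => a; apply: res_scalar.
Qed.

(** The residue field at [x] is [k], with [ev] the evaluation of sections over [U]. *)
Definition rational_at U x (ev : {rmorphism sec U -> k}) : Prop :=
  [/\ U x, forall a, ev (scalar U a) = a & forall s, invertible_at s x <-> ev s <> 0].

Lemma rational_at_res U W (h : W `<=` U) x (ev : {rmorphism sec W -> k}) :
  rational_at x ev -> rational_at x (ev \o res h : {rmorphism sec U -> k}).
Proof.
move=> [Wx evs inv]; split=> [|a|s]; first exact: h.
  by rewrite /= res_scalar.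
by rewrite -inv invertible_at_res.
Qed.

Lemma rational_at_sub U W (h : W `<=` U) x (ev : {rmorphism sec U -> k}) :
  affine_open U -> rational_at x ev -> W x ->
  exists ev' : {rmorphism sec W -> k}, rational_at x ev' /\ forall s, ev' (res h s) = ev s.
Proof.
move=> aff [Ux evs inv] Wx; have [f [fx fW]] := affine_nbhd aff Wx Ux.
have loc := affine_localization f aff.
have [e eE] := localization_extend loc ((inv f).1 fx).
have re : rational_at (U := basicU f) x e.
  split=> // [a|s]; first by rewrite -(res_scalar (@basicU_sub U f)) eE.
  have [_ /(_ s)[g [n E]] _] := loc.
  have ef0 : e (res (@basicU_sub U f) f ^+ n) <> 0.
    rewrite rmorphXn /= eE; apply/eqP; rewrite expf_eq0 negb_and; apply/orP; right.
    by apply/eqP/inv.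
  have : invertible_at (s * res (@basicU_sub U f) f ^+ n) x <-> e (s * res (@basicU_sub U f) f ^+ n) <> 0.
    by rewrite E eE -inv invertible_at_res.
  rewrite invertible_atM rmorphM => H; split=> [sx|es].
    move=> es; apply: H.1; last by rewrite es mul0r.
    by split=> //; apply: invertible_atX; apply/invertible_at_res.
  by apply: (H.2 _).1; apply/eqP; rewrite mulf_neq0 //; apply/eqP.
exists (e \o res fW); split; first exact: rational_at_res.
by move=> s /=; rewrite (res_comp h fW (@basicU_sub U f)).
Qed.

(* Clearing denominators of a presentation of u in a smaller neighbourhood. *)
Lemma ideal_sq_descent U W (h : W `<=` U) x (ev : {rmorphism sec U -> k})
    (ev' : {rmorphism sec W -> k}) (u : sec U) :
    affine_open U -> rational_at x ev -> rational_at x ev' ->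
    (forall s, ev' (res h s) = ev s) -> ideal_sq (fun s => ev' s = 0) (res h u) ->
  exists2 g, ev g <> 0 & ideal_sq (fun s => ev s = 0) (g * u).
Proof.
move=> aff [Ux evs inv] [Wx evs' inv'] ev'E sq.
have [f [fx fW]] := affine_nbhd aff Wx Ux.
have [finv frac tor] := affine_localization f aff.
set hf := @basicU_sub U f in finv frac tor.
have ef : ev f != 0 by apply/eqP/inv.
have clear (t : sec W) : ev' t = 0 -> exists2 g, ev g = 0 & exists n, res fW t * res hf f ^+ n = res hf g.
  move=> t0; have [g [n E]] := frac (res fW t); exists g; last by exists n.
  apply/eqP/negPn/negP => /eqP /inv.
  rewrite -(invertible_at_res hf) // -E => /invertible_atM[+ _].
  by rewrite invertible_at_res // => /inv'; apply.
have [N [v [sqv vE]]] : exists N v, ideal_sq (fun s => ev s = 0) v /\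
    res fW (res h u) * res hf f ^+ N = res hf v.
  elim: sq => [|s t w /clear[s' s'0 [n sE]] /clear[t' t'0 [m tE]] _ [N [v [sqv vE]]]].
    by exists 0%N, 0; rewrite !rmorph0 mul0r; split=> //; constructor.
  exists (n + m + N)%N, (s' * t' * f ^+ N + v * f ^+ (n + m)); split.
    by apply: ideal_sqD; rewrite mulrC; apply: ideal_sqMl => //; apply: ideal_sqM.
  rewrite !rmorphD !rmorphM !rmorphXn /= -vE -sE -tE !exprD; ring.
have /tor[M] : res hf (u * f ^+ N - v) = 0.
  by rewrite rmorphB rmorphM rmorphXn -vE (res_comp h fW hf) subrr.
rewrite mulrBr => /eqP; rewrite subr_eq0 => /eqP E.
exists (f ^+ M * f ^+ N); first by rewrite rmorphM !rmorphXn /=; apply/eqP; rewrite mulf_neq0 ?expf_neq0.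
by rewrite mulrAC -mulrA E; apply: ideal_sqMl.
Qed.

Lemma smooth_nbhd (W : opens X) x d :
    (exists U, [/\ U x, affine_open U & standard_smooth (scalar U) d]) -> W x ->
  exists U, [/\ U x, affine_open U, standard_smooth (scalar U) d & U `<=` W].
Proof.
move=> [U [Ux aff sm]] Wx; have [f [fx fW]] := affine_nbhd aff Wx Ux.
exists (basicU f); split=> //; first exact: affine_basic.
exact: basic_standard_smooth.
Qed.

End RingedSpace.

(** The Nullstellensatz gives an evaluation killing the point ideal of [x]; its kernel is the ideal
    of [y]. The condition on opens says that [y] lies in the closure of [x]. *)
Lemma affine_rational_specialization (k : closedFieldType) (X : ringed_space k) (U : opens X) d (x : X) :
  affine_open U -> standard_smooth (scalar U) d -> U x ->
  exists y (ev : {rmorphism sec U -> k}), rational_at y ev /\ forall W : opens X, W y -> W x.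
Proof.
move=> aff [c [xs [f [gen _ _]]]] Ux; have [prime point _ _] := aff.
have Px := prime x Ux.
have [ev [ev1 ev2 _]] := nullstellensatz_fg (phi := scalarR U) gen Px (prime1 Px).
have [y [[Uy yE] _]] := point _ (prime_kernel ev).
have inv s : invertible_at s y <-> ev s <> 0.
  have := congr1 (fun Q : set (sec U) => Q s) yE; rewrite /point_ideal /= => <-.
  by split=> [? //|]; apply: contrapT.
exists y, ev; split=> // W Wy; have [g [gy gW]] := affine_nbhd aff Wy Uy.
apply: gW; apply: contrapT => ng.
by move/inv: gy; apply; apply: ev2.
Qed.

(** * Integral schemes: opens meet, and restriction is injective *)

Section Integral.
Variables (k : fieldType) (X : scheme k) (int : integral_scheme X).

Lemma integral_ring_sec (U : opens X) x : U x -> integral_ring (sec U).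
Proof. by move=> Ux; apply: int.2; exists x. Qed.

(** On a disjoint union the sections (1, 0) and (0, 1) would be nonzero with product zero. *)
Lemma integral_inter (U W : opens X) x y : U x -> W y -> exists z, U z /\ W z.
Proof.
move=> Ux Wy; apply: contrapT => no.
pose C b := if b then U else W.
pose Z : opens X := Opens (openU (open_setP U) (open_setP W)).
have hC b : C b `<=` Z by case: b => z; [left|right].
have ZE : open_set Z = \bigcup_b C b.
  apply/seteqP; split=> z; first by case=> ?; [exists true|exists false].
  by move=> [b _]; apply: hC.
have glue (s : forall b, sec (C b)) : exists t, forall b, res (hC b) t = s b.
  apply: sec_glue ZE _ => b b' V hb hb'.
  have [ebb'|nbb'] := eqVneq b b'.
    by move: hb'; rewrite -ebb' => hb'; congr (res _ _); apply: Prop_irrelevance.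
  apply/eqP; rewrite -subr_eq0; apply/eqP.
  have V0 : forall z, ~ V z.
    move=> z Vz; apply: no; exists z; have := hb _ Vz; have := hb' _ Vz.
    by case: b b' nbb' {hb hb'} => -[].
  (* The overlap is empty, hence covered by the empty family, so every section over it is zero. *)
  apply: (@sec_separated k X False V (fun=> V) (fun=> @subset_refl _ _)) => //.
  by apply/seteqP; split=> z; [move/V0|move=> [[]]].
have [s sE] := glue (fun b => if b then 1 else 0).
have [t tE] := glue (fun b => if b then 0 else 1).
have [_ dom] := @integral_ring_sec Z x (or_introl Ux).
have st0 : s * t = 0.
  apply: (@sec_separated k X bool Z C hC) ZE _ => b.
  by rewrite rmorphM sE tE; case: b; rewrite ?mul0r ?mulr0.
case: (dom s t st0) => [s0|t0].
  have := sE true; rewrite s0 rmorph0 => /esym.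
  by have [] := @integral_ring_sec (C true) x Ux.
have := tE false; rewrite t0 rmorph0 => /esym.
by have [] := @integral_ring_sec (C false) y Wy.
Qed.

(** Near each point of [U], a basic open of some [g] lies inside [W]. There [s] vanishes, so
    [g^n s = 0] with [g^n] nonzero, and the ring is a domain. *)
Lemma res_inj (U W : opens X) (h : W `<=` U) x (s : sec U) : W x -> res h s = 0 -> s = 0.
Proof.
move=> Wx s0.
have /choice[C CP] : forall y : {y : X | U y}, exists Z : opens X,
    [/\ Z (sval y), Z `<=` U & forall hZ : Z `<=` U, res hZ s = 0].
  move=> [y Uy]; have [U0 [U0y aff0]] := schemeP y.
  have [f [fy fU]] := affine_nbhd aff0 Uy U0y.
  exists (basicU f); split=> // hZ; have aff := affine_basic f aff0.
  have [z [Zz Wz]] := @integral_inter (basicU f) W y x fy Wx.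
  have [g [gz gW]] := affine_nbhd aff Wz Zz.
  have [_ _ /(_ (res hZ s)) tor] := affine_localization g aff.
  have : res (@basicU_sub _ _ _ g) (res hZ s) = 0.
    by rewrite (res_comp hZ _ (subset_trans gW h)) -(res_comp h gW) s0 rmorph0.
  move=> /tor[n]; have [one dom] := integral_ring_sec Zz => /dom[gn|//].
  have : invertible_at (g ^+ n) z by apply: invertible_atX.
  rewrite gn => -[V [hV [Vz [w]]]]; rewrite rmorph0 mul0r => /esym.
  by have [] := integral_ring_sec Vz.
apply: (@sec_separated _ _ _ U C (fun y => let: And3 _ h _ := CP y in h)).
  apply/seteqP; split=> y; last by move=> [z _]; have [_ + _] := CP z; apply.
  by move=> Uy; exists (exist _ y Uy) => //; have [] := CP (exist _ y Uy).
by move=> y; have [_ _ H] := CP y.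
Qed.

End Integral.

(** * The modification over an affine open *)

Section SpectralIdeal.
Variables (A P : comPzRingType) (p : {rmorphism A -> P}) (x y : P) (b1 b2 b3 : A).
Hypothesis poly : polynomial_algebra p [tuple x; y].
Hypothesis bE : b3 ^+ 2 = b1 * b2.

Local Notation expo := {ffun 'I_2 -> nat}.
Let mon (m : expo) : P := monomial [tuple x; y] m.
Let i0 : 'I_2 := ord0.
Let i1 : 'I_2 := lift ord0 ord0.

Let monE m : mon m = x ^+ m i0 * y ^+ m i1.
Proof. by rewrite /mon /monomial !big_ord_recl big_ord0 mulr1 !(tnth_nth 0). Qed.

Let shift (i j : nat) (m : expo) : expo := [ffun l => if l == i0 then m l + i else m l + j]%N.

Let mon_shift i j m : mon (shift i j m) = x ^+ i * y ^+ j * mon m.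
Proof. by rewrite !monE !ffunE /= !exprD; ring. Qed.

(* The reduction of x^i y^j modulo the ideal, if i + j is even. *)
Let L (i j : nat) : A :=
  if odd (i + j) then 0 else b1 ^+ i./2 * b2 ^+ j./2 * (if odd i then b3 else 1).

Let Lxx i j : L i.+2 j = b1 * L i j.
Proof. by rewrite /L /= !negbK; case: ifP => _; rewrite ?mulr0 // exprS !mulrA. Qed.

Let Lyy i j : L i j.+2 = b2 * L i j.
Proof.
rewrite /L !addnS /= !negbK; case: ifP => _; rewrite ?mulr0 // exprS.
by case: ifP => _; ring.
Qed.

Let Lxy i j : L i.+1 j.+1 = b3 * L i j.
Proof.
rewrite /L addnS addSn /= negbK oddD; case oi: (odd i); case oj: (odd j) => //=;
  rewrite ?mulr0 // !uphalf_half oi oj /= ?add0n ?add1n; last by ring.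
by rewrite !exprS; transitivity (b3 ^+ 2 * (b1 ^+ i./2 * b2 ^+ j./2)); [rewrite bE; ring|ring].
Qed.

(* a is the constant term of f reduced modulo the ideal. *)
Let Lam (f : P) (a : A) := exists l : seq (A * expo),
  f = \sum_(z <- l) p z.1 * mon z.2 /\ a = \sum_(z <- l) z.1 * L (z.2 i0) (z.2 i1).

Let LamD f g a b : Lam f a -> Lam g b -> Lam (f + g) (a + b).
Proof. by move=> [l [-> ->]] [l' [-> ->]]; exists (l ++ l'); rewrite !big_cat. Qed.

Let Lam_mon c m : Lam (p c * mon m) (c * L (m i0) (m i1)).
Proof. by exists [:: (c, m)]; rewrite !big_seq1. Qed.

Let LamN f a : Lam f a -> Lam (- f) (- a).
Proof.
move=> [l [-> ->]]; exists [seq (- z.1, z.2) | z <- l]; rewrite !big_map -!sumrN.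
by split; apply: eq_bigr => z _; rewrite ?rmorphN mulNr.
Qed.

(** Grouping terms by monomial and using their freeness, [Lam] is the graph of a well-defined
    [A]-linear form. *)
Let Lam_zero a : Lam 0 a -> a = 0.
Proof.
move=> [l [E ->]]; pose S := undup [seq z.2 | z <- l].
pose C m := \sum_(z <- l | z.2 == m) z.1.
have group (R : zmodType) (F : A * expo -> R) :
    \sum_(z <- l) F z = \sum_(m <- S) \sum_(z <- l | z.2 == m) F z.
  rewrite (exchange_big_dep xpredT) //= big_seq [RHS]big_seq; apply: eq_bigr => z zl.
  rewrite (eq_bigl (pred1 z.2)); last by move=> m; rewrite /= eq_sym.
  by rewrite -big_filter filter_pred1_uniq ?undup_uniq ?mem_undup ?map_f ?big_seq1.
have [_ free] := poly.
have C0 m : m \in S -> C m = 0.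
  apply: free => //; first exact: undup_uniq.
  rewrite [RHS]E group; apply: eq_bigr => m' _; rewrite rmorph_sum big_distrl.
  by apply: eq_bigr => z /eqP <-.
rewrite group big_seq big1 // => m /C0 Cm.
transitivity (C m * L (m i0) (m i1)); last by rewrite Cm mul0r.
by rewrite big_distrl; apply: eq_bigr => z /eqP <-.
Qed.

Let Lam_relation q i j c : (forall u v, L (u + i) (v + j) = c * L u v) ->
  Lam (q * (x ^+ i * y ^+ j - p c)) 0.
Proof.
move=> Lc; have [M [e ->]] := poly.1 q.
rewrite big_distrl /=; elim: M => [|m M IH].
  by rewrite big_nil; exists [::]; rewrite !big_nil.
rewrite big_cons -(addr0 (0 : A)); apply: LamD => //.
have := LamD (Lam_mon (e m) (shift i j m)) (LamN (Lam_mon (e m * c) m)).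
rewrite mon_shift !ffunE /= Lc [e m * (c * _)]mulrA subrr => H.
by rewrite -/(mon m); congr (Lam _ 0): H; rewrite rmorphM; ring.
Qed.

(** The linear form [Lam] sends 1 to 1, kills [x] and [y] by parity, and kills the ideal. The
    relation [b3^2 = b1 b2] is what makes the reduction of [x y] to [b3] consistent when both
    exponents are odd. *)
Lemma spectral_ideal_const a b c q1 q2 q3 :
  p a + p b * x + p c * y =
    q1 * (x ^+ 2 - p b1) + q2 * (y ^+ 2 - p b2) + q3 * (x * y - p b3) -> a = 0.
Proof.
move=> E; apply: Lam_zero.
pose m0 : expo := [ffun=> 0%N].
have m0E : mon m0 = 1 by rewrite monE !ffunE !expr0 mulr1.
have La : Lam (p a) a.
  by have := Lam_mon a m0; rewrite m0E mulr1 !ffunE /L /= !mul1r !mulr1.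
have Lb : Lam (p b * x) 0.
  have := Lam_mon b (shift 1 0 m0); rewrite mon_shift m0E !mulr1.
  by rewrite !ffunE /= ?ffunE /L /= mulr0.
have Lc : Lam (p c * y) 0.
  have := Lam_mon c (shift 0 1 m0); rewrite mon_shift m0E mulr1 mul1r.
  by rewrite !ffunE /= ?ffunE /L /= mulr0.
have R1 : Lam (q1 * (x ^+ 2 - p b1)) 0.
  have := @Lam_relation q1 2 0 b1; rewrite mulr1 => H; apply: H => u v.
  by rewrite addn0 addn2 Lxx.
have R2 : Lam (q2 * (y ^+ 2 - p b2)) 0.
  have := @Lam_relation q2 0 2 b2; rewrite mul1r => H; apply: H => u v.
  by rewrite addn0 addn2 Lyy.
have R3 : Lam (q3 * (x * y - p b3)) 0.
  have H := @Lam_relation q3 1 1 b3; apply: H => u v.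
  by rewrite !addn1 Lxy.
have := LamD (LamD (LamD La Lb) Lc) (LamN (LamD (LamD R1 R2) R3)).
by rewrite E subrr !addr0 subr0.
Qed.

Lemma spectral_generated (B : comPzRingType) (Q : {rmorphism P -> B}) :
    Q x ^+ 2 = Q (p b1) -> Q y ^+ 2 = Q (p b2) -> Q x * Q y = Q (p b3) ->
  forall f, exists a b c, Q f = Q (p a) + Q (p b) * Q x + Q (p c) * Q y.
Proof.
move=> xx yy xy f; have [M [e ->]] := poly.1 f; rewrite rmorph_sum.
pose span (s : B) := exists a b c, s = Q (p a) + Q (p b) * Q x + Q (p c) * Q y.
have spanD s t : span s -> span t -> span (s + t).
  move=> [a [b [c ->]]] [a' [b' [c' ->]]]; exists (a + a'), (b + b'), (c + c').
  by rewrite !rmorphD; ring.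
have spanA a s : span s -> span (Q (p a) * s).
  move=> [a' [b [c ->]]]; exists (a * a'), (a * b), (a * c).
  by rewrite !rmorphM; ring.
have spanx s : span s -> span (Q x * s).
  move=> [a [b [c ->]]]; exists (b * b1 + c * b3), a, 0.
  by rewrite !(rmorph0, rmorphD, rmorphM) -xx -xy; ring.
have spany s : span s -> span (Q y * s).
  move=> [a [b [c ->]]]; exists (b * b3 + c * b2), 0, a.
  by rewrite !(rmorph0, rmorphD, rmorphM) -yy -xy; ring.
have span1 : span 1 by exists 1, 0, 0; rewrite !(rmorph0, rmorph1); ring.
apply: (big_ind span) => [||m _] /=; [|exact: spanD|]; first by exists 0, 0, 0; rewrite !rmorph0; ring.
rewrite rmorphM; apply: spanA; rewrite -/(mon m) monE rmorphM !rmorphXn.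
elim: (m i0) => [|i IH]; last by rewrite exprS -mulrA; apply: spanx.
rewrite expr0 mul1r; elim: (m i1) => [|i IH]; first by rewrite expr0.
by rewrite exprS; apply: spany.
Qed.

End SpectralIdeal.

(** * Frames and components of sections *)

Section Frames.
Variables (k : fieldType) (X : ringed_space k).

Lemma frame_restrict (V : module_sheaf X) (U W : opens X) (h : W `<=` U) (v1 v2 : V U) :
  frame [tuple v1; v2] -> frame [tuple mres V h v1; mres V h v2].
Proof.
move=> fr Z hZ v; have [a [aE auniq]] := fr Z (subset_trans hZ h) v.
have E (c : 2.-tuple (sec Z)) :
    \sum_(i < 2) tnth c i *: mres V hZ (tnth [tuple mres V h v1; mres V h v2] i) =
    \sum_(i < 2) tnth c i *: mres V (subset_trans hZ h) (tnth [tuple v1; v2] i).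
  rewrite !big_ord_recl !big_ord0 !(tnth_nth 0) /=.
  by rewrite !(mres_comp h hZ (subset_trans hZ h)).
exists a; split; first by rewrite E.
by move=> c; rewrite E; apply: auniq.
Qed.

Lemma frame_expand (V : module_sheaf X) (U : opens X) (v1 v2 v3 : V U) (v : V U) :
  frame [tuple v1; v2; v3] -> exists a b c, v = a *: v1 + b *: v2 + c *: v3.
Proof.
move=> /(_ U (@subset_refl _ _) v)[a [-> _]].
exists (tnth a ord0), (tnth a (lift ord0 ord0)), (tnth a (lift ord0 (lift ord0 ord0))).
by rewrite !big_ord_recl big_ord0 addr0 !(tnth_nth 0) /= !mres_id addrA.
Qed.

Lemma frame_near (V : vector_bundle X 2) x : exists (U : opens X) (v1 v2 : V U),
  U x /\ frame [tuple v1; v2].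
Proof.
have [U [e [Ux fr]]] := vb_locally_free V x.
exists U, (tnth e ord0), (tnth e (lift ord0 ord0)); split=> //.
have -> // : [tuple tnth e ord0; tnth e (lift ord0 ord0)] = e.
apply/eq_from_tnth => i; case: (unliftP ord0 i) => [j ->|->]; last by rewrite !(tnth_nth 0).
by rewrite [j]ord1 !(tnth_nth 0).
Qed.

End Frames.

Section Components.
Variables (k : fieldType) (X : scheme k) (V : vector_bundle X 2) (S : sym_square V).
Variable b : S (fullU X).

Lemma components_restrict (U W : opens X) (h : W `<=` U) (v1 v2 : V U) b1 b2 b3 :
  components b v1 v2 b1 b2 b3 ->
  components b (mres V h v1) (mres V h v2) (res h b1) (res h b2) (res h b3).
Proof.
move=> [fr E]; split; first exact: frame_restrict.
rewrite -(mres_comp (@sub_fullU _ U) h) E !raddfD /= !mresZ !sprod_res.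
by rewrite rmorphMn.
Qed.

Lemma components_exist (U : opens X) (v1 v2 : V U) : (2%:R : k) != 0 ->
  frame [tuple v1; v2] -> exists b1 b2 b3, components b v1 v2 b1 b2 b3.
Proof.
move=> two fr; have [b1 [b2 [b3 E]]] := frame_expand (mres S (@sub_fullU _ U) b) (sprod_frame (s := S) fr).
exists b1, b2, (scalar U 2%:R^-1 * b3); split=> //; rewrite E; congr (_ + _ *: _).
have -> : (scalar U 2%:R^-1 * b3) *+ 2 = (scalarR U 2%:R^-1 * scalarR U 2%:R) * b3.
  by rewrite rmorph_nat; ring.
by rewrite -rmorphM mulVf // rmorph1 mul1r.
Qed.

End Components.

Section Modification.
Variables (k : fieldType) (X : scheme k) (int : integral_scheme X).
Variables (V : vector_bundle X 2) (S : sym_square V) (b : S (fullU X)).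
Variables (E : total_space V) (Y : spectral_curve E b) (Yt : modification (sc_proj Y)).
Hypothesis hb : hitchin_base b.

(* The name is shadowed by the coordinates of vector. *)
Local Notation coord := Defs.coord.
Local Notation pE := (ts_proj E).
Local Notation pY := (sc_proj Y).

Definition mod_preim (U : opens X) : opens Yt := inv_im (mod_incl Yt) (inv_im pY U).

Definition coord_ring_map (U : opens X) : {rmorphism sec U -> sec (mod_preim U)} :=
  pullback (mod_incl Yt) (inv_im pY U) \o pull_comp pE (sc_incl Y) U.

Definition fibre_map (U : opens X) : {rmorphism sec (inv_im pE U) -> sec (mod_preim U)} :=
  pullback (mod_incl Yt) (inv_im pY U) \o
    res (@inv_im_comp_sub _ _ _ _ pE (sc_incl Y) U) \o pullback (sc_incl Y) (inv_im pE U).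

Lemma fibre_map_pullback U a : fibre_map U (pullback pE U a) = coord_ring_map U a.
Proof. by []. Qed.

Lemma coord_ring_map_scalar U a : coord_ring_map U (scalar U a) = scalar (mod_preim U) a.
Proof.
transitivity (pullback (mod_incl Yt) (inv_im pY U) (scalar (inv_im pY U) a)); last exact: pull_scalar.
by congr (pullback _ _ _); apply: pull_comp_scalar.
Qed.

Lemma inv_im_scE U : inv_im pY U = inv_im (sc_incl Y) (inv_im pE U).
Proof. exact: opens_eq. Qed.

Lemma affine_scE U : affine_open U -> affine_open (inv_im pY U).
Proof. by move=> aff; rewrite inv_im_scE; apply: (sc_closed Y).1; apply: ts_affine. Qed.

Lemma affine_over U : affine_open U -> affine_open (mod_preim U).
Proof. by move=> aff; apply: (mod_closed Yt).1; apply: affine_scE. Qed.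

Lemma res_sym_surj (Z : ringed_space k) (U W : opens Z) (h : W `<=` U) (h' : U `<=` W) (s : sec W) :
  exists t, res h t = s.
Proof. by exists (res h' s); rewrite (res_comp h' h (@subset_refl _ _)) res_id. Qed.

Lemma fibre_map_surj U : affine_open U -> forall s, exists f, fibre_map U f = s.
Proof.
move=> aff s; have [t <-] := (mod_closed Yt).2 _ (affine_scE aff) s.
have h' : inv_im (sc_incl Y) (inv_im pE U) `<=` inv_im pY U by [].
have [u <-] := res_sym_surj (@inv_im_comp_sub _ _ _ _ pE (sc_incl Y) U) h' t.
have [f <-] := (sc_closed Y).2 _ (@ts_affine _ _ _ E _ aff) u.
by exists f.
Qed.

Let rY U : {rmorphism sec (inv_im (sc_incl Y) (inv_im pE U)) -> sec (inv_im pY U)} :=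
  res (@inv_im_comp_sub _ _ _ _ pE (sc_incl Y) U).

Lemma fibre_map0 U f : affine_open U ->
  fibre_map U f = 0 <-> torsion_section (rY U (pullback (sc_incl Y) _ f)).
Proof. by move=> aff; apply: mod_ideal. Qed.

(** A section that becomes torsion after multiplication by a nonzero [a] is torsion; restrictions of
    [a] stay nonzero by [res_inj]. *)
Lemma fibre_map_torsion_free U f a : affine_open U -> a <> 0 ->
  fibre_map U (pullback pE U a * f) = 0 -> fibre_map U f = 0.
Proof.
move=> aff a0 /fibre_map0 => /(_ aff) tor; apply/fibre_map0 => // x Ux.
have [W [h [a' [Wx a'0 E0]]]] := tor x Ux.
exists W, h, (a' * res h a); split=> //.
  have [_ dom] := integral_ring_sec int Wx; case/dom => // /(res_inj int Wx).
  exact: a0.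
rewrite rmorphM -mulrA -[RHS]E0; congr (_ * _).
have -> : rY U (pullback (sc_incl Y) _ (pullback pE U a * f)) =
    pullback pY U a * rY U (pullback (sc_incl Y) _ f) by rewrite !rmorphM.
rewrite rmorphM; congr (_ * _).
exact: pull_res.
Qed.

Lemma coord_restrict (U W : opens X) (h : W `<=` U) (v1 v2 : V U) : frame [tuple v1; v2] ->
  res (inv_im_sub pE h) (coord E v1 v2).1 = (coord E (mres V h v1) (mres V h v2)).1 /\
  res (inv_im_sub pE h) (coord E v1 v2).2 = (coord E (mres V h v1) (mres V h v2)).2.
Proof.
move=> fr.
have [|| -> ->] := @ts_coord_change _ _ _ E U W h v1 v2 _ _ 1 0 0 1 fr (frame_restrict h fr).
- by rewrite scale1r scale0r addr0.
- by rewrite scale1r scale0r add0r.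
- by rewrite !rmorph1 !rmorph0 !mul1r !mul0r addr0 add0r.
Qed.

(** Turns a vanishing on the modification into a vanishing on the spectral curve over a smaller
    affine open, where the ideal is explicit. *)
Lemma fibre_map_local U f x : affine_open U -> U x -> fibre_map U f = 0 ->
  exists (D : opens X) (h : D `<=` U) (a : sec D), [/\ affine_open D, D x, a <> 0 &
    pullback (sc_incl Y) _ (pullback pE D a * res (inv_im_sub pE h) f) = 0].
Proof.
move=> aff Ux /fibre_map0 => /(_ aff) /(_ x Ux)[W [hW [a [Wx a0 E0]]]].
have [g [gx gW]] := affine_nbhd aff Wx Ux.
pose D := basicU g; pose h : D `<=` U := @basicU_sub _ _ U g.
exists D, h, (res gW a); split=> //; first exact: affine_basic.
  by move=> r0; apply: a0; apply: (res_inj int (W := D) gx r0).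
have inj (s : sec (inv_im (sc_incl Y) (inv_im pE D))) : rY D s = 0 -> s = 0.
  move=> s0; have h' : inv_im (sc_incl Y) (inv_im pE D) `<=` inv_im pY D by [].
  have := congr1 (res h') s0; rewrite rmorph0 (res_comp _ h' (@subset_refl _ _)).
  by rewrite res_id.
apply: inj; rewrite !rmorphM.
transitivity (res (inv_im_sub pY gW) (pullback pY W a * res (inv_im_sub pY hW) (rY U (pullback (sc_incl Y) _ f)))); last first.
  by rewrite E0 rmorph0.
rewrite rmorphM; congr (_ * _).
  exact: (pull_res gW (inv_im_sub pY gW) a).
rewrite (res_comp _ _ (inv_im_sub pY h)).
have -> : pullback (sc_incl Y) (inv_im pE D) (res (inv_im_sub pE h) f) =
    res (inv_im_sub (sc_incl Y) (inv_im_sub pE h)) (pullback (sc_incl Y) _ f).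
  exact: pull_res.
have h1 : inv_im pY D `<=` inv_im (sc_incl Y) (inv_im pE U) by move=> y; apply: h.
by rewrite /rY (res_comp _ _ h1) (res_comp _ (inv_im_sub pY h) h1).
Qed.

Lemma spectral_algebra_over U (v1 v2 : V U) b1 b2 b3 x :
    affine_open U -> U x -> components b v1 v2 b1 b2 b3 ->
  spectral_algebra (coord_ring_map U)
    (fibre_map U (coord E v1 v2).1) (fibre_map U (coord E v1 v2).2) b1 b2 b3.
Proof.
move=> aff Ux comp; have [fr _] := comp.
have := sc_ideal Y aff comp; set X1 := (coord E v1 v2).1; set Y1 := (coord E v1 v2).2.
move=> /= ideal.
have rel f q1 q2 q3 : f = q1 * (X1 ^+ 2 - pullback pE U b1) + q2 * (Y1 ^+ 2 - pullback pE U b2)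
    + q3 * (X1 * Y1 - pullback pE U b3) -> fibre_map U f = 0.
  move=> fE; have f0 : pullback (sc_incl Y) _ f = 0 by apply/ideal; exists q1, q2, q3.
  by rewrite /fibre_map /= f0 !rmorph0.
have xx : fibre_map U X1 ^+ 2 = fibre_map U (pullback pE U b1).
  apply/eqP; rewrite -rmorphXn -subr_eq0 -rmorphB; apply/eqP.
  by apply: (rel _ 1 0 0); rewrite mul1r !mul0r !addr0.
have yy : fibre_map U Y1 ^+ 2 = fibre_map U (pullback pE U b2).
  apply/eqP; rewrite -rmorphXn -subr_eq0 -rmorphB; apply/eqP.
  by apply: (rel _ 0 1 0); rewrite mul1r !mul0r addr0 add0r.
have xy : fibre_map U X1 * fibre_map U Y1 = fibre_map U (pullback pE U b3).
  apply/eqP; rewrite -rmorphM -subr_eq0 -rmorphB; apply/eqP.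
  by apply: (rel _ 0 0 1); rewrite mul1r !mul0r !add0r.
split=> // [s|a c d|a s a0].
- have [f <-] := fibre_map_surj aff s.
  exact: (spectral_generated (@ts_polynomial _ _ _ E _ _ _ aff fr) xx yy xy f).
(* A nonzero [e] moves the relation into the spectral ideal near [x]. There [spectral_ideal_const]
   gives [e a = 0], hence [a = 0] by integrality. *)
- rewrite -!fibre_map_pullback -!rmorphM -!rmorphD => /(fibre_map_local aff Ux)[D [h [e [affD Dx e0]]]].
  have compD := components_restrict h comp.
  have [frD _] := compD.
  have [rX rY1] := coord_restrict h fr.
  move=> /(sc_ideal Y affD compD)[q1 [q2 [q3]]].
  rewrite !rmorphD !rmorphM /= rX rY1.
  have pr u : res (inv_im_sub pE h) (pullback pE U u) = pullback pE D (res h u).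
    exact/esym/pull_res.
  rewrite !pr.
  rewrite [LHS](_ : _ = pullback pE D (e * res h a)
    + pullback pE D (e * res h c) * (coord E (mres V h v1) (mres V h v2)).1
    + pullback pE D (e * res h d) * (coord E (mres V h v1) (mres V h v2)).2); last first.
    by rewrite !rmorphM; ring.
  move=> /(spectral_ideal_const (@ts_polynomial _ _ _ E _ _ _ affD frD) (hb compD)).
  have [_ dom] := integral_ring_sec int Dx.
  by move=> /dom[//|]; apply: (res_inj int Dx).
- have [f <-] := fibre_map_surj aff s.
  rewrite -fibre_map_pullback -rmorphM; exact: fibre_map_torsion_free.
Qed.

End Modification.

(** * Smoothness and multiple zeros *)

Lemma ideal_sq_rmorph (A B : comPzRingType) (f : {rmorphism A -> B}) (I : A -> Prop) (J : B -> Prop) s :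
  (forall s, I s -> J (f s)) -> ideal_sq I s -> ideal_sq J (f s).
Proof.
move=> IJ; elim=> [|u v t Iu Iv _ IH]; first by rewrite rmorph0; constructor.
by rewrite rmorphD rmorphM; apply: ideal_sqDM => //; apply: IJ.
Qed.

Section Vanishing.
Variables (k : fieldType) (X : ringed_space k).

Lemma vanishes_of_ideal_sq (U : opens X) x (ev : {rmorphism sec U -> k}) (s : sec U) :
  rational_at x ev -> ideal_sq (fun s => ev s = 0) s -> vanishes_to_order 2 s x.
Proof.
move=> [Ux _ inv] sq; exists U, (@subset_refl _ _); split=> //; rewrite res_id.
have ninv t : ev t = 0 -> point_ideal x t by move=> t0 /inv; apply.
elim: sq => [|u v t u0 v0 _ [m [a [r [rP ->]]]]].
  by exists 0%N, (fun=> 0), (fun _ _ => 0); split=> [[]//|]; rewrite big_ord0.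
exists m.+1, (ocons 1 a), (ocons (fun j => tnth [tuple u; v] j) r); split.
  move=> i j; case: (unliftP ord0 i) => [i' ->|->]; rewrite ?ocons0 ?oconsS //.
  by case: (unliftP ord0 j) => [j' ->|->]; apply: ninv; rewrite (tnth_nth 0) //= ord1.
rewrite big_ord_recl !ocons0 mul1r !big_ord_recl big_ord0 mulr1 !(tnth_nth 0) /=.
by congr (_ + _); apply: eq_bigr => i _; rewrite !oconsS.
Qed.

(** A factor invertible at the specialization [y] would be invertible at [x], so the expression of
    order 2 at [x] is also one at [y]. *)
Lemma ideal_sq_of_vanishes (U W : opens X) (h : W `<=` U) x y
    (ev : {rmorphism sec W -> k}) (s : sec U) :
    rational_at y ev -> W x -> (forall Z : opens X, Z y -> Z x) ->
    (exists (W0 : opens X) (h0 : W0 `<=` U), W `<=` W0 /\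
      exists (m : nat) (a : 'I_m -> sec W0) (t : 'I_m -> 'I_2 -> sec W0),
      (forall i j, point_ideal x (t i j)) /\ res h0 s = \sum_(i < m) a i * \prod_(j < 2) t i j) ->
  ideal_sq (fun s => ev s = 0) (res h s).
Proof.
move=> [Wy evs inv] Wx sp [W0 [h0 [hW [m [a [t [tP E]]]]]]].
rewrite -(res_comp h0 hW) E rmorph_sum; apply: ideal_sq_sum => i.
rewrite rmorphM; apply: ideal_sqMl; rewrite !big_ord_recl big_ord0 mulr1 rmorphM.
have t0 j : ev (res hW (t i j)) = 0.
  apply/eqP/negPn/negP => /eqP /inv iy; apply: (tP i j).
  by apply/(invertible_at_res hW) => //; apply: (sp (basicU (res hW (t i j)))).
by apply: ideal_sqM; apply: t0.
Qed.

End Vanishing.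

Section DoubleCover.
Variables (k : closedFieldType) (X : scheme k) (int : integral_scheme X).

Lemma scalarR_basic (U : opens X) (f : sec U) :
  res (@basicU_sub _ _ U f) \o scalarR U = scalar (basicU f) :> (k -> _).
Proof. by apply/funext => a; apply: res_scalar. Qed.

Lemma double_cover_nbhd (U : opens X) x (ev : {rmorphism sec U -> k}) g b3 :
    affine_open U -> standard_smooth (scalar U) 1 -> rational_at x ev ->
    ev g <> 0 \/ [/\ ev g = 0, ~ ideal_sq (fun s => ev s = 0) g & ev b3 = 0] ->
  exists (D : opens X) (h : D `<=` U), [/\ affine_open D, D x, standard_smooth (scalar D) 1,
    res h g <> 0 /\ (exists c, res h b3 = c * res h g) &
    invertible (res h g) \/ exists2 Delta, invertible Delta & parameter (scalar D) (res h g) Delta].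
Proof.
move=> aff sm [Ux evs inv] [g0|[g0 ng b30]].
  have gx := (inv g).2 g0; have [[z gz] _ _] := affine_localization g aff.
  exists (basicU g), (@basicU_sub _ _ U g); split=> //; first exact: affine_basic.
  - exact: basic_standard_smooth.
  - split; last by exists (res (@basicU_sub _ _ U g) b3 * z); rewrite -mulrA [z * _]mulrC gz mulr1.
    by move/(res_inj int (W := basicU g) gx) => g00; apply: g0; rewrite g00 rmorph0.
  - by left; exists z.
have sm' : standard_smooth (scalarR U) 1 by exact: sm.
have [Delta D0 par] := curve_parameter (phi := scalarR U) evs sm' g0 ng.
have [delta d0 dP] := parameter_principal (phi := scalarR U) evs par g0 D0.
pose f := delta * Delta; have fx : invertible_at f x by apply/invertible_atM; rewrite !inv.
have loc := affine_localization f aff; have [finv _ _] := loc.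
set h := @basicU_sub _ _ U f in loc finv.
have [dinv Dinv] : invertible (res h delta) /\ invertible (res h Delta).
  move: finv; rewrite rmorphM => finv; split; first exact: invertibleMl finv.
  by move: finv; rewrite mulrC; apply: invertibleMl.
exists (basicU f), h; split=> //; first exact: affine_basic.
- exact: basic_standard_smooth.
- split.
    move/(res_inj int (W := basicU f) fx) => g00; apply: ng; rewrite g00; constructor.
  have [w /(congr1 (res h)) wE] := dP _ b30; have [z dz] := dinv.
  exists (z * res h w); rewrite -mulrA -rmorphM -wE rmorphM mulrA [z * _]mulrC dz mul1r.
  by [].
- right; exists (res h (f * Delta)); first by rewrite rmorphM; apply: invertibleM.
  by have := parameter_localization loc par; rewrite scalarR_basic.
Qed.

Variables (two : (2%:R : k) != 0).
Hypothesis smX : forall x : X, smooth_at 1 x.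
Variables (V : vector_bundle X 2) (S : sym_square V) (b : S (fullU X)).
Hypothesis hb : hitchin_base' b.
Variables (E : total_space V) (Y : spectral_curve E b) (Yt : modification (sc_proj Y)).

(** The generic point lies in every nonempty open; if [b1 = b2 = 0] then [b3^2 = 0] gives [b3 = 0],
    and [b] would vanish there. *)
Lemma components_nonzero (U : opens X) (v1 v2 : V U) b1 b2 b3 x : U x ->
  components b v1 v2 b1 b2 b3 -> ~ (b1 = 0 /\ b2 = 0).
Proof.
move=> Ux comp [b10 b20]; have [hB [eta [gen nv]]] := hb; apply: nv.
have Ueta : U eta.
  have : closure [set eta] x by rewrite gen.
  move=> /(_ U)[|y [-> //]].
  by apply: open_nbhs_nbhs; split=> //; apply: open_setP.
have [_ dom] := integral_ring_sec int Ux.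
have b30 : b3 = 0.
  have := hB U v1 v2 b1 b2 b3 comp; rewrite b10 mul0r expr2 => /dom.
  by case.
have van : vanishes_to_order 1 (0 : sec U) eta.
  exists U, (@subset_refl _ _); split=> //.
  by exists 0%N, (fun=> 0), (fun _ _ => 0); split=> [[]//|]; rewrite big_ord0 rmorph0.
exists U, v1, v2, b1, b2, b3; split=> //; by rewrite ?b10 ?b20 ?b30.
Qed.

Lemma smooth_preim (D : opens X) x u v g g' b3 :
    spectral_algebra (coord_ring_map Yt D) u v g g' b3 -> D x -> standard_smooth (scalar D) 1 ->
    g <> 0 /\ (exists c, b3 = c * g) ->
    invertible g \/ (exists2 Delta, invertible Delta & parameter (scalar D) g Delta) ->
  standard_smooth (scalar (mod_preim Yt D)) 1.
Proof.
move=> sa Dx sm [g0 [c cE]] good.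
have := standard_smooth_spectral (phi := scalarR D) sa (integral_ring_sec int Dx) two g0 cE sm good.
suff -> : coord_ring_map Yt D \o scalarR D = scalar (mod_preim Yt D) :> (k -> _) by [].
by apply/funext => a; apply: coord_ring_map_scalar.
Qed.
Lemma smooth_of_no_multiple_zero : ~ (exists x, multiple_zero b x) -> smooth_scheme Yt.
Proof.
move=> nmz yt; set p := sc_proj Y (mod_incl Yt yt); exists 1%N.
have [U1 [v1' [v2' [U1p fr]]]] := frame_near V p.
have [U [Up aff sm hU]] := smooth_nbhd (smX p) U1p.
have [b1 [b2 [b3 comp]]] := components_exist b two (frame_restrict hU fr).
have [q [ev [rat sp]]] := affine_rational_specialization aff sm Up.
have [Uq evs inv] := rat.
have bE : b3 ^+ 2 = b1 * b2 by apply: hb.1 comp.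
(* A neighbourhood of the specialization [q] contains the image [p], so its preimage is a chart
   around the given point. *)
suff [D [Dq affD smD]] : exists D : opens X,
    [/\ D q, affine_open D & standard_smooth (scalar (mod_preim Yt D)) 1].
  by exists (mod_preim Yt D); split=> //; [exact: (sp D)|exact: affine_over].
pose I (s : sec U) := ev s = 0.
suff [c1|c2] : (ev b1 <> 0 \/ [/\ ev b1 = 0, ~ ideal_sq I b1 & ev b3 = 0]) \/
               (ev b2 <> 0 \/ [/\ ev b2 = 0, ~ ideal_sq I b2 & ev b3 = 0]).
- have [D [h [affD Dq smD ? ?]]] := double_cover_nbhd aff sm rat c1.
  have sa := spectral_algebra_over int Yt hb.1 affD Dq (components_restrict h comp).
  by exists D; split=> //; apply: (smooth_preim sa Dq).
- have [D [h [affD Dq smD ? ?]]] := double_cover_nbhd aff sm rat c2.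
  have sa := spectral_algebra_over int Yt hb.1 affD Dq (components_restrict h comp).
  by exists D; split=> //; apply: (smooth_preim (spectral_algebra_sym sa) Dq).
have [e1|] := pselect (ev b1 = 0); last by left; left.
have [e2|] := pselect (ev b2 = 0); last by right; left.
have e3 : ev b3 = 0.
  have := congr1 ev bE; rewrite rmorphXn rmorphM e1 mul0r => /eqP.
  by rewrite expf_eq0 => /andP[_ /eqP].
have [s1|] := pselect (ideal_sq I b1); last by left; right.
have [s2|] := pselect (ideal_sq I b2); last by right; right.
(* The tangent cone of [X] itself is a domain: [b3 * b3 = b2 * b1] with [b1] in the square and [b2]
   vanishing. *)
have s3 : ideal_sq I b3.
  have sm' : standard_smooth (scalarR U) 1 by exact: sm.
  have [] // := smooth_tangent_cone_domain (phi := scalarR U) evs sm' e3 e3 e2 s1.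
  by rewrite -expr2 bE mulrC.
case: nmz; exists q, U, (mres V hU v1'), (mres V hU v2'), b1, b2, b3.
by split=> //; apply: vanishes_of_ideal_sq rat _.
Qed.

Lemma multiple_zero_singular x : multiple_zero b x -> ~ smooth_scheme Yt.
Proof.
move=> [U0 [v1 [v2 [b1 [b2 [b3 [U0x comp van1 van2 van3]]]]]]] smY.
have [W1 [h1 [W1x van1']]] := van1; have [W2 [h2 [W2x van2']]] := van2.
have [W3 [h3 [W3x van3']]] := van3.
(* A chart inside all three neighbourhoods keeps the order-2 expressions valid at the rational
   specialization [q]. *)
pose W := interU (interU W1 W2) W3.
have Wx : W x by [].
have [U [Ux aff sm hUW]] := smooth_nbhd (smX x) Wx.
have hU1 : U `<=` W1 by move=> z /hUW[[]].
have hU2 : U `<=` W2 by move=> z /hUW[[]].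
have hU3 : U `<=` W3 by move=> z /hUW[].
have hU : U `<=` U0 := subset_trans hU1 h1.
have [q [ev [rat sp]]] := affine_rational_specialization aff sm Ux.
have [Uq evs inv] := rat.
have s1 : ideal_sq (fun s => ev s = 0) (res hU b1).
  by apply: (@ideal_sq_of_vanishes k X U0 U hU x q ev b1 rat Ux sp); exists W1, h1.
have s2 : ideal_sq (fun s => ev s = 0) (res hU b2).
  by apply: (@ideal_sq_of_vanishes k X U0 U hU x q ev b2 rat Ux sp); exists W2, h2.
have s3 : ideal_sq (fun s => ev s = 0) (res hU b3).
  by apply: (@ideal_sq_of_vanishes k X U0 U hU x q ev b3 rat Ux sp); exists W3, h3.
have sm' : standard_smooth (scalarR U) 1 by exact: sm.
have [t [Delta [t0 D0 par]]] := curve_has_parameter (phi := scalarR U) evs sm'.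
have [delta d0 dP] := parameter_principal (phi := scalarR U) evs par t0 D0.
pose D := basicU delta; pose h : D `<=` U := @basicU_sub _ _ U delta.
have Dq : D q by apply/inv.
have affD : affine_open D := affine_basic delta aff.
have [[z dz] frac _] := affine_localization delta aff.
rewrite -/h in dz frac.
have [ev' [rat' ev'E]] := rational_at_sub h aff rat Dq.
have [_ evs' inv'] := rat'.
have gen s : ev s = 0 -> exists w, res h s = w * res h t.
  move=> /dP[w /(congr1 (res h))]; rewrite !rmorphM => wE; exists (z * res h w).
  by rewrite -mulrA -wE mulrA [z * _]mulrC dz mul1r.
have t_gen s : ev' s = 0 -> exists w, s = w * res h t.
  move=> s0; have [g [n gE]] := frac s.
  have /gen[w wE] : ev g = 0 by rewrite -ev'E -gE rmorphM s0 mul0r.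
  exists (w * z ^+ n); rewrite mulrAC -wE -gE -mulrA -exprMn dz expr1n mulr1.
  by [].
(* Over [D], where [delta] is invertible, [t] generates the maximal ideal, hence [t^2] its
   square. *)
have tt s : ideal_sq (fun s => ev s = 0) s -> exists c, res h s = res h t ^+ 2 * c.
  elim=> [|u v s' /gen[wu uE] /gen[wv vE] _ [c cE]].
    by exists 0; rewrite rmorph0 mulr0.
  by exists (wu * wv + c); rewrite rmorphD rmorphM uE vE cE; ring.
have [c1 c1E] := tt _ s1; have [c2 c2E] := tt _ s2; have [c3 c3E] := tt _ s3.
have compD := components_restrict h (components_restrict hU comp).
have sa := spectral_algebra_over int Yt hb.1 affD Dq compD.
have t0' : ev' (res h t) = 0 by rewrite ev'E.
have evt0 c : ev' (res h t ^+ 2 * c) = 0 by rewrite rmorphM rmorphXn t0' expr2 !mul0r.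
have [evB evBE] : exists evB : {rmorphism sec (mod_preim Yt D) -> k}, forall a b0 c,
    evB (coord_ring_map Yt D a + coord_ring_map Yt D b0 *
        fibre_map Yt D (Defs.coord E (mres V h (mres V hU v1)) (mres V h (mres V hU v2))).1
      + coord_ring_map Yt D c *
        fibre_map Yt D (Defs.coord E (mres V h (mres V hU v1)) (mres V h (mres V hU v2))).2) = ev' a.
  by apply: (spectral_point sa); rewrite ?c1E ?c2E ?c3E evt0.
have affO := affine_over Yt affD.
have [_ point _ _] := affO.
(* The point of the modification over [q] where both fibre coordinates vanish. *)
have [y [[Oy yE] _]] := point _ (prime_kernel evB).
have ratB : rational_at y evB.
  split=> // [a|s].
    rewrite -coord_ring_map_scalar -[RHS]evs' -(evBE (scalar D a) 0 0).
    by rewrite !rmorph0 !mul0r !addr0.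
  have := congr1 (fun Q : set (sec (mod_preim Yt D)) => Q s) yE; rewrite /point_ideal /= => <-.
  by split=> [? //|]; apply: contrapT.
have [d smy] := smY y.
have [C [Cy affC smC hC]] := smooth_nbhd smy Oy.
have [evC [ratC evCE]] := rational_at_sub hC affO ratB Cy.
have [_ evsC _] := ratC.
have smC' : standard_smooth (scalarR C) d by exact: smC.
apply: (multiple_zero_not_smooth (phi := scalarR D) sa
  evs' t0' t_gen c1E c2E c3E (components_nonzero Dq compD) evBE).
move=> u v w s u0 v0 w0 sq uv.
have sqC : ideal_sq (fun s => evC s = 0) (res hC s).
  by apply: ideal_sq_rmorph sq => s' s0; rewrite evCE.
have z0 (r : sec (mod_preim Yt D)) : evB r = 0 -> evC (res hC r) = 0 by rewrite evCE.
have uvC : res hC u * res hC v = res hC w * res hC s by rewrite -!rmorphM uv.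
(* The smooth chart [C] may be smaller than the preimage of [D]; the cone property holds on [C], and
   descent introduces the factor [h] of the cone hypothesis. *)
have [/(ideal_sq_descent affO ratB ratC evCE)|/(ideal_sq_descent affO ratB ratC evCE)] :=
  smooth_tangent_cone_domain (phi := scalarR C) evsC smC' (z0 _ u0) (z0 _ v0) (z0 _ w0) sqC uvC.
- by left.
- by right.
Qed.

End DoubleCover.

Theorem proposition3p14 (R : realType) (X : scheme R[i])
    (hX : smooth_projective_curve X) (V : vector_bundle X 2)
    (S : sym_square V) (b : S (fullU X)) (hb : hitchin_base' b)
    (E : total_space V) (Y : spectral_curve E b)
    (Yt : modification (sc_proj Y)) (hirr : irreducible_space Yt) :
  smooth_scheme Yt <-> ~ exists x : X, multiple_zero b x.
Proof.
have [int _ smX] := hX.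
have two : (2%:R : R[i]) != 0 by rewrite pnatr_eq0.
split=> [smY [x mz]|nmz].
  exact: (@multiple_zero_singular R[i] X int smX V S b hb E Y Yt x mz smY).
exact: (@smooth_of_no_multiple_zero R[i] X int two smX V S b hb E Y Yt nmz).
Qed.
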